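(* The space $\mathbb{RT}^{\rm nc}_{h0}$ admits a basis (a set of linearly independent functions spanning it) whose members belong to $\bigoplus_{M\in\mathcal{X}_h}\mathcal{B}_M$ and are each supported on two adjacent triangles. The space $\mathbb{RT}^{\rm nc}_h$ admits a basis consisting of two types of functions, Type I and Type II. The functions of Type I belong to $\bigoplus_{M\in\mathcal{X}_h^i}\mathcal{B}_M$ and are each supported on two adjacent triangles, and the functions of Type II belong to $\bigoplus_{M\in\mathcal{X}_h^b}\mathcal{C}_M$ and are each supported on one triangle.
   Context: $\Omega\subset\mathbb{R}^2$ is a polygon and $\mathcal{T}_h$ is a shape-regular (conforming) triangulation of $\Omega$ such that every boundary vertex is connected by an edge to at least one interior vertex. $\mathcal{X}_h,\mathcal{X}_h^i,\mathcal{X}_h^b$ are the sets of all, interior, and boundary vertices. Two triangles are adjacent if they share an edge. $(\cdot,\cdot)_T$ is the $L^2(T)$ inner product. $\mathbb{V}^1_h$ is the space of continuous piecewise linear functions on $\mathcal{T}_h$, $\mathbb{V}^1_{h0}=\mathbb{V}^1_h\cap H^1_0(\Omega)$, and $\psi_M\in\mathbb{V}^1_h$ is the nodal basis function with $\psi_M(M)=1$ vanishing at all other vertices. $\mathbb{RT}(T)=\{\alpha+\beta x:\alpha\in\mathbb{R}^2,\beta\in\mathbb{R}\}$ (vector fields on $T$, $x$ the position vector), and $\mathbb{RT}(\mathcal{T}_h)$ is the space of vector fields on $\Omega$ whose restriction to each $T$ lies in $\mathbb{RT}(T)$ (no continuity). Define $\mathbb{RT}^{\rm nc}_h=\{\tau_h\in\mathbb{RT}(\mathcal{T}_h):\sum_{T\in\mathcal{T}_h}(\tau_h,\nabla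 v_h)_T+({\rm div}\,\tau_h,v_h)_T=0\ \forall\,v_h\in\mathbb{V}^1_{h0}\}$, and $\mathbb{RT}^{\rm nc}_{h0}$ in the same way with the condition for all $v_h\in\mathbb{V}^1_h$. For a triangle $T$ with vertices $a_1,a_2,a_3$ and area $S$, let $b_T^{a_i}(x)=\frac{1}{2S}(x+a_i-a_j-a_k)$, $\{i,j,k\}=\{1,2,3\}$; these form a basis of $\mathbb{RT}(T)$. $E_T^\Omega$ denotes extension by zero from $T$ to $\Omega$. For $M\in\mathcal{X}_h$, $\mathcal{C}_M=\bigoplus_{T\ni M}{\rm span}\{E_T^\Omega b_T^M\}$ (sum over triangles having $M$ as a vertex) and $\mathcal{B}_M=\{\tau_h\in\mathcal{C}_M:\sum_{T\in\mathcal{T}_h}(\tau_h,\nabla\psi_M)_T+({\rm div}\,\tau_h,\psi_M)_T=0\}$. *)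

(* Defs.v *)
From HB Require Import structures.
From mathcomp Require Import all_boot all_order all_algebra.
From mathcomp Require Import all_classical all_reals all_analysis.
Set Implicit Arguments.
Unset Strict Implicit.
Unset Printing Implicit Defensive.
Import Order.TTheory GRing.Theory Num.Theory.
Import numFieldNormedType.Exports.
Local Open Scope classical_set_scope.
Local Open Scope ring_scope.

(* The library norm on [R * R] is the sup norm; it is used only through the
   topology and boundedness. Euclidean lengths are given by [edist]. *)
Notation plane R := (R * R)%type.

Definition dot (R : realType) (x y : plane R) : R := x.1 * y.1 + x.2 * y.2.

Definition edist (R : realType) (x y : plane R) : R :=
  Num.sqrt (dot (x - y) (x - y)).

Definition lebesgue2 (R : realType) :=
  ((@lebesgue_measure R) \x (@lebesgue_measure R))%E.

Definition frontier (R : realType) (A : set (plane R)) : set (plane R) :=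
  closure A `\` A°.

Definition supp (R : realType) (f : plane R -> plane R) : set (plane R) :=
  closure [set x | f x != 0].

Definition grad (R : realType) (v : plane R -> R) (x : plane R) : plane R :=
  ('D_((1, 0) : plane R) v x, 'D_((0, 1) : plane R) v x).

Definition div (R : realType) (f : plane R -> plane R) (x : plane R) : R :=
  'D_((1, 0) : plane R) (fun y => (f y).1) x
  + 'D_((0, 1) : plane R) (fun y => (f y).2) x.

Definition seg (R : realType) (p q : plane R) : set (plane R) :=
  [set (1 - t) *: p + t *: q | t in [set t : R | 0 <= t <= 1]].

(* Corners are listed cyclically: the i-th side joins [p i] to [p (ordS i)].
   Flat angles are allowed. *)
Definition simple_closed_polyline (R : realType) (n : nat)
    (p : 'I_n -> plane R) : Prop :=
  [/\ (3 <= n)%N, injective p &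
      forall i j : 'I_n, i != j ->
        seg (p i) (p (ordS i)) `&` seg (p j) (p (ordS j)) `<=`
        [set p i; p (ordS i)] `&` [set p j; p (ordS j)]].

(* The bounded domain enclosed by a simple closed polygonal line.  The
   condition that [Omega] is the interior of its closure (it lies on one side
   of its boundary) follows from the others by the Jordan curve theorem. *)
Definition polygon (R : realType) (Omega : set (plane R)) : Prop :=
  [/\ open Omega, connected Omega, bounded_set Omega,
      (closure Omega)° = Omega &
      exists (n : nat) (p : 'I_n -> plane R),
        simple_closed_polyline p /\
        frontier Omega = \bigcup_(i : 'I_n) seg (p i) (p (ordS i))].

(* A cell is the set of its vertices. *)
Record mesh (R : realType) := Mesh {
  vertex : finType;
  coord : vertex -> plane R;
  cells : {set {set vertex}} }.

Section Mesh.
Context (R : realType) (Th : mesh R).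
Implicit Types (T : {set vertex Th}) (M : vertex Th).

(* The closed simplex spanned by the vertices in [T]. *)
Definition hull T : set (plane R) :=
  [set x | exists l : vertex Th -> R,
     [/\ forall i, 0 <= l i, \sum_(i in T) l i = 1 &
         x = \sum_(i in T) l i *: coord i]].

Definition affinely_independent T : Prop :=
  forall c : vertex Th -> R,
    \sum_(i in T) c i = 0 -> \sum_(i in T) c i *: coord i = 0 ->
    forall i, i \in T -> c i = 0.

(* In [tri_conforming], [hull set0 = set0]: two distinct triangles are disjoint
   or meet exactly in a common vertex or in a common edge. *)
Record is_triangulation (Omega : set (plane R)) : Prop := {
  tri_coord_inj : injective (@coord R Th);
  tri_vertex : forall M, exists2 T, T \in cells Th & M \in T;
  tri_card : forall T, T \in cells Th -> #|T| = 3;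
  tri_nondegenerate : forall T, T \in cells Th -> affinely_independent T;
  tri_conforming : forall T T', T \in cells Th -> T' \in cells Th -> T != T' ->
    hull T `&` hull T' = hull (T :&: T');
  tri_cover : \bigcup_(T in [set` cells Th]) hull T = closure Omega }.

(* [gamma] bounds the ratio of the diameter of a cell to the diameter of its
   largest inscribed disc. *)
Definition diameter T : R :=
  sup [set r : R | exists x y, [/\ hull T x, hull T y & r = edist x y]].

Definition indiameter T : R :=
  sup [set d : R | exists r c, [/\ 0 <= r, d = 2 * r &
                     [set x | edist x c <= r] `<=` hull T]].

Definition shape_regular (gamma : R) : Prop :=
  forall T, T \in cells Th -> diameter T <= gamma * indiameter T.

Definition adjacent T T' : Prop :=
  [/\ T \in cells Th, T' \in cells Th, T != T' & #|T :&: T'| = 2].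

Definition edge M M' : Prop :=
  M != M' /\ exists2 T, T \in cells Th & (M \in T) && (M' \in T).

Definition interior_vertex (Omega : set (plane R)) M : bool :=
  `[< Omega (coord M) >].

Definition boundary_vertex (Omega : set (plane R)) M : bool :=
  `[< frontier Omega (coord M) >].

(* Functions on the closure of [Omega] are represented by functions on the
   plane whose values elsewhere are irrelevant. *)
Definition V1 (Omega : set (plane R)) : set (plane R -> R) :=
  [set v | {within closure Omega, continuous v} /\
     forall T, T \in cells Th ->
       exists g c, forall x, hull T x -> v x = dot g x + c].

(* Functions of [V1] in H^1_0: the trace of a function continuous up to the
   boundary is its restriction to the boundary. *)
Definition V10 (Omega : set (plane R)) : set (plane R -> R) :=
  [set v | V1 Omega v /\ forall x, frontier Omega x -> v x = 0].

Definition nodal (Omega : set (plane R)) M : set (plane R -> R) :=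
  [set v | V1 Omega v /\ forall M', v (coord M') = (M' == M)%:R].

(* The nodal function is unique on the closure of [Omega]; [xget] picks a
   representative. *)
Definition psi (Omega : set (plane R)) M : plane R -> R :=
  xget (fun=> 0) (nodal Omega M).

(* An element of RT(T_h) is determined by its values on the open triangles; it
   is represented by the function vanishing at all other points (the edges,
   which form a null set, and the exterior of [Omega]), so that equality of
   fields is equality of functions. *)
Definition RT : set (plane R -> plane R) :=
  [set tau |
    (forall T, T \in cells Th -> exists (alpha : plane R) (beta : R),
       forall x, (hull T)° x -> tau x = alpha + beta *: x) /\
    (forall x, (forall T, T \in cells Th -> ~ (hull T)° x) -> tau x = 0)].

(* Integrals over [T] are taken over its interior, where the derivatives of
   piecewise polynomial functions are classical. *)
Definition pairing (tau : plane R -> plane R) (v : plane R -> R) : R :=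
  \sum_(T in cells Th)
    (\int[@lebesgue2 R]_(x in (hull T)°) dot (tau x) (grad v x)
     + \int[@lebesgue2 R]_(x in (hull T)°) (div tau x * v x)).

Definition RTnc (Omega : set (plane R)) : set (plane R -> plane R) :=
  [set tau | RT tau /\ forall v, V10 Omega v -> pairing tau v = 0].

Definition RTnc0 (Omega : set (plane R)) : set (plane R -> plane R) :=
  [set tau | RT tau /\ forall v, V1 Omega v -> pairing tau v = 0].

Definition area T : R := fine (@lebesgue2 R (hull T)).

(* x + a_i - a_j - a_k, scaled, for M = a_i and T = {a_i, a_j, a_k} *)
Definition bT T M (x : plane R) : plane R :=
  (2 * area T)^-1 *: (x + coord M - \sum_(j in T :\ M) coord j).

Definition ext0 T (f : plane R -> plane R) : plane R -> plane R :=
  patch (fun=> 0) (hull T)° f.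

End Mesh.

Definition line (R : realType) (V : lmodType R) (f : V) : set V :=
  [set c *: f | c in [set: R]].

Definition independent_sum (V : zmodType) (I : finType) (P : pred I)
    (W : I -> set V) : Prop :=
  forall g : I -> V, (forall i, P i -> W i (g i)) ->
    \sum_(i | P i) g i = 0 -> forall i, P i -> g i = 0.

(* Membership in the internal direct sum of the subspaces [W i], [P i];
   writing it entails that the sum is direct. *)
Definition dsum (V : zmodType) (I : finType) (P : pred I) (W : I -> set V) :
    set V :=
  [set f | independent_sum P W /\
     exists2 g : I -> V, forall i, P i -> W i (g i) &
                         f = \sum_(i | P i) g i].

Definition is_basis (R : realType) (V : lmodType R) (W : set V) (n : nat)
    (e : 'I_n -> V) : Prop :=
  (forall c : 'I_n -> R, \sum_i c i *: e i = 0 -> forall i, c i = 0) /\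
  W = [set \sum_i c i *: e i | c in [set: 'I_n -> R]].

Definition CM (R : realType) (Th : mesh R) (M : vertex Th) :
    set (plane R -> plane R) :=
  dsum [pred T : {set vertex Th} | (T \in cells Th) && (M \in T)]
       (fun T => line (ext0 T (bT T M))).

Definition BM (R : realType) (Th : mesh R) (Omega : set (plane R))
    (M : vertex Th) : set (plane R -> plane R) :=
  [set tau | CM M tau /\ pairing Th tau (psi Omega M) = 0].

Definition on_two_adjacent (R : realType) (Th : mesh R)
    (tau : plane R -> plane R) : Prop :=
  exists T T' : {set vertex Th},
    adjacent T T' /\ supp tau `<=` hull T `|` hull T'.

Definition on_one (R : realType) (Th : mesh R)
    (tau : plane R -> plane R) : Prop :=
  exists2 T : {set vertex Th}, T \in cells Th & supp tau `<=` hull T.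

Definition typeI (R : realType) (Th : mesh R) (Omega : set (plane R))
    (tau : plane R -> plane R) : Prop :=
  dsum (@interior_vertex R Th Omega) (@BM R Th Omega) tau /\
  on_two_adjacent Th tau.

Definition typeII (R : realType) (Th : mesh R) (Omega : set (plane R))
    (tau : plane R -> plane R) : Prop :=
  dsum (@boundary_vertex R Th Omega) (@CM R Th) tau /\ on_one Th tau.

(* Main.v *)
(* The field b_T^M is dual to evaluation at the vertices of T: its pairing with a
   function v affine on T equals v(M). Hence a field of RT(T_h) is a family of
   coefficients c(T, M), M in T, and its pairing with v is the sum over the
   vertices M of v(M) times the residual sum_(T containing M) c(T, M). Testing
   with the hat functions, RT^nc_{h0} is the space of fields all of whose
   residuals vanish, and RT^nc_h that of fields whose residuals vanish at the
   interior vertices (the hat function of an interior vertex is zero on the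
   frontier). The fields at M with zero residual are spanned by the differences
   b_T^M - b_T'^M over adjacent T, T' as soon as the triangles around M are
   connected through their common edges at M. If they were not, each of two
   components would have at least two edges at M lying in a single triangle:
   the edges at M in exactly one triangle of a component are even in number, and
   without any the component would fill a neighbourhood of M. These four
   edges lie in the frontier, whereas at most two sides of a simple polygonal line
   leave M. Finally, a finite spanning family contains a basis.

   The duality needs only that the integral of an affine function over a triangle
   is its area times the mean of the vertex values; it follows from the behaviour of
   Lebesgue measure under homotheties and the division of the triangle into four
   homothetic copies. *)

Require Import Defs.
From mathcomp Require Import all_boot all_order all_algebra.
From mathcomp Require Import all_classical all_reals all_analysis.
From mathcomp Require Import measurable_realfun ring lra.
Import Order.TTheory GRing.Theory Num.Theory.
Import numFieldNormedType.Exports.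
Local Open Scope classical_set_scope.
Local Open Scope ring_scope.

Set Implicit Arguments.
Unset Strict Implicit.
Unset Printing Implicit Defensive.

(* [vector] exports another [coord]. *)
Local Notation coord := Defs.coord.

(** * Affine functions and barycentric coordinates *)

Section Plane.
Context (R : realType).
Implicit Types (x y : plane R) (k : R).

Lemma fst_scale k x : (k *: x).1 = k * x.1. Proof. by []. Qed.
Lemma snd_scale k x : (k *: x).2 = k * x.2. Proof. by []. Qed.
Lemma scaleRE k (l : R) : k *: (l : R^o) = k * l. Proof. by []. Qed.

Lemma fst_sum (I : Type) (r : seq I) (P : pred I) (F : I -> plane R) :
  (\sum_(i <- r | P i) F i).1 = \sum_(i <- r | P i) (F i).1.
Proof. by elim/big_rec2: _ => // i y1 y2 _ <-. Qed.

Lemma snd_sum (I : Type) (r : seq I) (P : pred I) (F : I -> plane R) :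
  (\sum_(i <- r | P i) F i).2 = \sum_(i <- r | P i) (F i).2.
Proof. by elim/big_rec2: _ => // i y1 y2 _ <-. Qed.

Lemma plane_eq x y : x.1 = y.1 -> x.2 = y.2 -> x = y.
Proof. by case: x y => [x1 x2] [y1 y2] /= -> ->. Qed.

Definition planeE := (fst_scale, snd_scale, scaleRE, fst_sum, snd_sum).

Definition affine (p : plane R * R) x : R := dot p.1 x + p.2.

Lemma affine_sum (I : finType) (T : {set I}) (l : I -> R) (a : I -> plane R) p :
  \sum_(i in T) l i = 1 ->
  affine p (\sum_(i in T) l i *: a i) = \sum_(i in T) l i * affine p (a i).
Proof.
move=> l1; rewrite /affine /dot !planeE.
rewrite -[p.2 in LHS]mul1r -l1 mulr_suml !mulr_sumr -!big_split.
by apply: eq_bigr => i _ /=; rewrite !planeE; ring.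
Qed.

Lemma affine_conv p t x y :
  affine p ((1 - t) *: x + t *: y) = (1 - t) * affine p x + t * affine p y.
Proof. by rewrite /affine /dot /= !planeE; ring. Qed.

Lemma continuous_affine p : continuous (affine p).
Proof.
move=> x; rewrite /affine /dot; apply: cvgD; last exact: cvg_cst.
apply: cvgD; apply: cvgM; (try exact: cvg_cst).
  exact: cvg_fst.
exact: cvg_snd.
Qed.

Lemma continuous_segment x y : continuous (fun t : R => (1 - t) *: x + t *: y).
Proof.
move=> t; apply: cvgD; apply: cvgZ; (try exact: cvg_cst); (try exact: cvg_id).
by apply: cvgB; [exact: cvg_cst|exact: cvg_id].
Qed.

Lemma cvg_segment x y : ((1 - t) *: x + t *: y) @[t --> (0 : R)] --> x.
Proof.
by have := @continuous_segment x y 0;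
  rewrite /continuous_at subr0 scale1r scale0r addr0.
Qed.

Lemma affine_near_gt0 p x : 0 < affine p x -> \forall y \near x, 0 < affine p y.
Proof.
move=> px.
exact: (@cvgr_gt R _ (nbhs x) (nbhs_filter x) (affine p) (affine p x)
  (@continuous_affine p x) 0 px).
Qed.

End Plane.

Lemma card3_split (I : finType) (T : {set I}) : #|T| = 3 ->
  exists p q r, [/\ p != q, p != r, q != r, T = [set p; q; r]%SET &
    forall (V : nmodType) (F : I -> V), \sum_(i in T) F i = F p + F q + F r].
Proof.
move=> T3; have := enum_uniq T; have := mem_enum T;
  have : size (enum T) = 3 by rewrite -cardE.
move=> + + uT; have := @big_enum _ _ _ I (mem T) .
case: (enum T) uT => [//|p [//|q [//|r [|//]]]] /=.
rewrite !inE andbT negb_or => /andP[/andP[pq pr] qr] bT _ eT.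
exists p, q, r; split => //.
  by apply/setP => i; rewrite -eT !inE orbA.
by move=> V F; rewrite -(bT V +%R 0) !big_cons big_nil /= addr0 addrA.
Qed.

Lemma card3_other (I : finType) (T : {set I}) i : #|T| = 3 ->
  exists2 j, j \in T & j != i.
Proof.
move=> /card3_split[p [q [r [pq _ _ -> _]]]].
have [->|ip] := eqVneq i p; last by exists p; rewrite ?inE ?eqxx// eq_sym.
by exists q; rewrite ?inE ?eqxx ?orbT// eq_sym.
Qed.

(** * Barycentric coordinates of a nondegenerate triangle *)

Section Triangle.
Context (R : realType) (Th : mesh R) (T : {set vertex Th}).

(** The coefficients vanish at vertices off [T], so that sign conditions on the coordinates can
    range over all vertices of the mesh. *)
Definition is_bary (b : vertex Th -> plane R * R) : Prop :=
  (forall i, i \notin T -> b i = 0) /\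
  forall x, \sum_(i in T) affine (b i) x = 1 /\
            \sum_(i in T) affine (b i) x *: coord i = x.

Definition bary_coef : vertex Th -> plane R * R := xget (fun=> 0) is_bary.

Definition bary (i : vertex Th) (x : plane R) : R := affine (bary_coef i) x.

Hypotheses (T3 : #|T| = 3) (Tind : affinely_independent T).

Lemma is_bary_exists : exists b, is_bary b.
Proof.
have [p [q [r [pq pr qr defT sumT]]]] := card3_split T3.
pose u := coord q - coord p; pose w := coord r - coord p.
pose D := u.1 * w.2 - u.2 * w.1.
(* [D] is twice the signed area. Were it zero, the relations [E1] and [E2] would force [u] and [w]
   to vanish, against independence. *)
have D0 : D != 0.
  apply/eqP => D0.
  have dep s t : s *: u + t *: w = 0 -> s = 0 /\ t = 0.
    move=> st; pose c i := if i == q then s else if i == r then t else - s - t.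
    have cp : c p = - s - t by rewrite /c (negPf pq) (negPf pr).
    have cq : c q = s by rewrite /c eqxx.
    have cr : c r = t by rewrite /c eqxx eq_sym (negPf qr).
    have c0 : forall i, i \in T -> c i = 0.
      apply: Tind; rewrite sumT cp cq cr; first by ring.
      by rewrite -st /u /w; apply: plane_eq; rewrite /= !planeE; ring.
    by rewrite -cq -cr; split; apply: c0; rewrite defT !inE eqxx ?orbT.
  have E1 : w.2 *: u + (- u.2) *: w = 0.
    apply: plane_eq; rewrite /= !planeE.
      by rewrite -D0 /D /u /w /=; ring.
    by ring.
  have E2 : w.1 *: u + (- u.1) *: w = 0.
    apply: plane_eq; rewrite /= !planeE.
      by ring.
    by rewrite -[RHS]oppr0 -D0 /D /u /w /=; ring.
  have [w2 /eqP] := dep _ _ E1; rewrite oppr_eq0 => /eqP u2.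
  have [w1 /eqP] := dep _ _ E2; rewrite oppr_eq0 => /eqP u1.
  have E3 : 1 *: u + 0 *: w = 0.
    by rewrite scale1r scale0r addr0; apply: plane_eq.
  by have [/eqP] := dep _ _ E3; rewrite oner_eq0.
(* Cramer's rule: [bq] and [br] give the coefficients of [x - coord p] in the basis [u], [w]. *)
pose bq := (((w.2 / D, - w.1 / D) : plane R),
  - ((coord p).1 * w.2 - (coord p).2 * w.1) / D).
pose br := (((- u.2 / D, u.1 / D) : plane R),
  ((coord p).1 * u.2 - (coord p).2 * u.1) / D).
pose bp := (- bq.1 - br.1, 1 - bq.2 - br.2).
pose b i := if i == p then bp else if i == q then bq else if i == r then br else 0.
have b_p : b p = bp by rewrite /b eqxx.
have b_q : b q = bq by rewrite /b eqxx eq_sym (negPf pq).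
have b_r : b r = br by rewrite /b eqxx eq_sym (negPf pr) eq_sym (negPf qr).
exists b; split.
  move=> i; rewrite defT !inE !negb_or => /andP[/andP[ip iq] ir].
  by rewrite /b (negPf ip) (negPf iq) (negPf ir).
move=> x; rewrite !sumT b_p b_q b_r; split.
  by rewrite /affine /bp /dot /=; ring.
have Dn : u.1 * w.2 - u.2 * w.1 != 0 by [].
apply: plane_eq.
  rewrite /= !planeE /affine /bp /bq /br /dot /= /D.
  rewrite /u /w /= in Dn *.
  by field.
rewrite /= !planeE /affine /bp /bq /br /dot /= /D.
rewrite /u /w /= in Dn *.
by field.
Qed.

Lemma bary_coefP : is_bary bary_coef.
Proof. by have [b hb] := is_bary_exists; exact: (xgetI _ hb). Qed.

Lemma bary_out i x : i \notin T -> bary i x = 0.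
Proof.
by move=> iT; rewrite /bary (proj1 bary_coefP)// /affine /dot /= !mul0r !addr0.
Qed.

Lemma bary_sum x : \sum_(i in T) bary i x = 1.
Proof. exact: (proj2 bary_coefP x).1. Qed.

Lemma bary_comb x : \sum_(i in T) bary i x *: coord i = x.
Proof. exact: (proj2 bary_coefP x).2. Qed.

(** Two families of weights for the same point differ by an affine dependence. *)
Lemma bary_uniq (l : vertex Th -> R) x :
  \sum_(i in T) l i = 1 -> x = \sum_(i in T) l i *: coord i ->
  forall i, i \in T -> l i = bary i x.
Proof.
move=> l1 lx i iT; apply/eqP; rewrite -subr_eq0; apply/eqP.
apply: (Tind (c := fun i => l i - bary i x)) => //.
  by rewrite sumrB l1 bary_sum subrr.
by under eq_bigr do rewrite scalerBl; rewrite sumrB -lx bary_comb subrr.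
Qed.

Lemma bary_coord i j : i \in T -> j \in T -> bary i (coord j) = (i == j)%:R.
Proof.
move=> iT jT; symmetry; apply: (bary_uniq (l := fun i => (i == j)%:R)) => //.
  by rewrite (bigD1 j)//= eqxx big1 ?addr0// => k /andP[_ /negPf->].
rewrite (bigD1 j)//= eqxx scale1r big1 ?addr0// => k /andP[_ /negPf->].
by rewrite scale0r.
Qed.

Lemma affine_bary p x : affine p x = \sum_(i in T) bary i x * affine p (coord i).
Proof. by rewrite -[in LHS](bary_comb x) affine_sum// bary_sum. Qed.

Lemma hullP x : hull T x <-> forall i, 0 <= bary i x.
Proof.
split=> [[l [l0 l1 lx]] i|b0].
  have [iT|/bary_out ->//] := boolP (i \in T).
  by rewrite -(bary_uniq l1 lx iT).
by exists (bary^~ x); split => //; [exact: bary_sum|rewrite bary_comb].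
Qed.

Lemma closed_hull : closed (hull T).
Proof.
rewrite (_ : hull T = \bigcap_(i in [set: vertex Th]) [set x | 0 <= bary i x]).
  apply: closed_bigI => i _.
  exact: (closed_comp (fun y _ =>
    @continuous_affine R (bary_coef i) y) (@closed_ge R 0)).
by apply/seteqP; split=> x /=; [move=> /hullP h i _; exact: h|
  move=> h; apply/hullP => i; exact: h].
Qed.

(** Where coordinate [i] vanishes, a small step in the direction from vertex [i] to another vertex
    leaves the triangle. Conversely, finitely many strict inequalities persist nearby. *)
Lemma interior_hullP x : (hull T)° x <-> forall i, i \in T -> 0 < bary i x.
Proof.
split=> [xT i iT|b0].
  have /hullP b0 := interior_subset xT.
  rewrite lt_neqAle b0 andbT eq_sym; apply/eqP => bi0.
  have [j jT ji] := card3_other i T3.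
  have : \forall t \near (0 : R), hull T (x + t *: (coord i - coord j)).
    have ct : (x + t *: (coord i - coord j)) @[t --> (0 : R)] --> x.
      rewrite -[X in _ --> X]addr0 -(scale0r (coord i - coord j)).
      apply: cvgD; first exact: cvg_cst.
      by apply: cvgZ; [exact: cvg_id|exact: cvg_cst].
    exact: (ct _ xT).
  move=> /nbhs_ballP[e /= e0 /(_ (- (e / 2)))].
  rewrite /ball /= sub0r opprK gtr0_norm ?divr_gt0// => /(_ ltac:(lra)) /hullP /(_ i).
  have -> : bary i (x + - (e / 2) *: (coord i - coord j))
    = bary i x - e / 2 * (bary i (coord i) - bary i (coord j)).
    by rewrite /bary /affine /dot /= !planeE; ring.
  rewrite (bary_coord iT iT) (bary_coord iT jT) eqxx eq_sym (negPf ji) bi0 /=.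
  by move=> ?; lra.
have : nbhs x [set y | forall i, 0 <= bary i y].
  apply: (@filter_forall _ _ (fun i y => 0 <= bary i y) (nbhs x)) => i.
  have [iT|/bary_out iT] := boolP (i \in T); last by apply: nearW => y; rewrite iT.
  by apply: filterS (affine_near_gt0 (b0 i iT)) => y /ltW.
by apply: filterS => y /hullP.
Qed.

End Triangle.

(** * Integrals of affine functions over a triangle *)

Section Measure.
Context (R : realType).
Local Notation mu := (@lebesgue_measure R).
Local Notation mu2 := (@lebesgue2 R).

Definition homothety1 (c v : R) : measurableTypeR R -> measurableTypeR R :=
  fun x => c * x + v.

Lemma measurable_homothety1 c v : measurable_fun setT (homothety1 c v).
Proof. by apply: measurable_funD => //; exact: measurable_funM. Qed.

(** Both sides are measures in [A], so by uniqueness of Lebesgue measure half-open intervals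
    suffice. *)
Lemma lebesgue_measure_homothety (c v : R) (A : set R) : c != 0 ->
  measurable A ->
  mu A = (`|c|%:E * mu (homothety1 c v @^-1` A))%E.
Proof.
move=> c0 mA.
pose nu := mscale (NngNum (normr_ge0 c)) (pushforward mu (homothety1 c v)).
suff : forall X, ocitv X -> mu X = nu (measurable_homothety1 c v) X.
  by move=> /(@lebesgue_measure_unique R (nu _))/(_ A mA).
move=> _ [[a b]] _ <-; rewrite /nu /mscale /= /pushforward.
have [c_lt0|c_gt0|/eqP] := ltgtP c 0; last by rewrite (negPf c0).
(* A negative factor reverses the order: the preimage is closed on the left and open on the
   right. *)
- rewrite (_ : _ @^-1` _ = `[(b - v) / c, (a - v) / c[%classic); last first.
    by apply/seteqP; split=> x /=; rewrite !in_itv/= /homothety1;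
      rewrite ler_ndivrMr// ltr_ndivlMr// mulrC => /andP[? ?]; apply/andP; split; lra.
  rewrite !lebesgue_measure_itv/= !lte_fin ltr_nM2r ?invr_lt0//.
  have -> : (a - v < b - v) = (a < b) by apply/idP/idP; lra.
  case: ifP => ab; last by rewrite mule0.
  rewrite -!EFinD -EFinM; congr EFin.
  by rewrite ltr0_norm//; field; lra.
- rewrite (_ : _ @^-1` _ = `](a - v) / c, (b - v) / c]%classic); last first.
    by apply/seteqP; split=> x /=; rewrite !in_itv/= /homothety1;
      rewrite ler_pdivlMr// ltr_pdivrMr// mulrC => /andP[? ?]; apply/andP; split; lra.
  rewrite !lebesgue_measure_itv/= !lte_fin ltr_pM2r ?invr_gt0//.
  have -> : (a - v < b - v) = (a < b) by apply/idP/idP; lra.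
  case: ifP => ab; last by rewrite mule0.
  rewrite -!EFinD -EFinM; congr EFin.
  by rewrite gtr0_norm//; field; lra.
Qed.

Local Notation mplane := (measurableTypeR R * measurableTypeR R)%type.

Definition homothety (c : R) (v : plane R) (x : mplane) : mplane :=
  (c * x.1 + v.1, c * x.2 + v.2).

Lemma measurable_homothety c v :
  measurable_fun setT (homothety c v).
Proof.
apply/measurable_fun_pairP; split.
  exact: (measurableT_comp (measurable_homothety1 c v.1) measurable_fst).
exact: (measurableT_comp (measurable_homothety1 c v.2) measurable_snd).
Qed.

(** A product measure is determined by rectangles, on which each axis contributes a factor [|c|]. *)
Lemma lebesgue2_homothety c v (A : set mplane) : c != 0 ->
  measurable A ->
  mu2 A = ((c ^+ 2)%:E * mu2 (homothety c v @^-1` A))%E.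
Proof.
move=> c0 mA.
pose nu := mscale (NngNum (sqr_ge0 c)) (pushforward mu2 (homothety c v)).
suff E (B C : set (measurableTypeR R)) : measurable B -> measurable C ->
    nu (measurable_homothety c v) (B `*` C) = (mu B * mu C)%E.
  exact: (@product_measure_unique _ _ _ _ R mu mu (nu (measurable_homothety c v)) E _
    mA).
move=> mB mC; rewrite /nu /mscale /= /pushforward.
rewrite (_ : _ @^-1` _ = (homothety1 c v.1 @^-1` B) `*`
                         (homothety1 c v.2 @^-1` C)) //.
rewrite /lebesgue2 product_measure1E; last 2 first.
- by rewrite -[X in measurable X]setTI; exact: measurable_homothety1.
- by rewrite -[X in measurable X]setTI; exact: measurable_homothety1.
rewrite (lebesgue_measure_homothety v.1 c0 mB).
rewrite (lebesgue_measure_homothety v.2 c0 mC).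
rewrite muleACA -EFinM; congr (_%:E * _)%E.
by rewrite -normrM -expr2 ger0_norm// sqr_ge0.
Qed.

Lemma integral_homothety c v (f : mplane -> \bar R) : c != 0 ->
  measurable_fun setT f -> (forall x, (0 <= f x)%E) ->
  (\int[mu2]_x f x = (c ^+ 2)%:E * \int[mu2]_x f (homothety c v x))%E.
Proof.
move=> c0 mf f0.
pose nu := mscale (NngNum (sqr_ge0 c)) (pushforward mu2 (homothety c v)).
transitivity (\int[nu (measurable_homothety c v)]_x f x)%E.
  apply: eq_measure_integral => A mA _.
  exact: lebesgue2_homothety.
apply: etrans.
  by apply: (ge0_integral_mscale _ measurableT (NngNum (sqr_ge0 c))) => // x _.
apply: (congr1 (fun z => ((c ^+ 2)%:E * z)%E)).
have := @ge0_integral_pushforward _ _ _ _ R _ (measurable_homothety c v) mu2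
  setT f measurableT mf (fun x _ => f0 x).
by rewrite preimage_setT.
Qed.

End Measure.

(** * Area of a triangle and mean of an affine function over it *)

Section TriangleMeasure.
Context (R : realType).
Local Notation mu := (@lebesgue_measure R).
Local Notation mu2 := (@lebesgue2 R).
Local Notation mplane := (measurableTypeR R * measurableTypeR R)%type.

Lemma lebesgue2E (A B : set (measurableTypeR R)) : measurable A -> measurable B ->
  mu2 (A `*` B) = (mu A * mu B)%E.
Proof. exact: product_measure1E. Qed.

Lemma measurable_affine (D : set mplane) (p : plane R * R) :
  measurable_fun D (affine p : mplane -> R).
Proof.
apply: measurable_funTS; rewrite /affine /dot.
by apply: measurable_funD => //; apply: measurable_funD; apply: measurable_funM.
Qed.

Lemma measurable_affine_gt0 (p : plane R * R) :
  measurable ([set x | 0 < affine p x] : set mplane).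
Proof.
rewrite (_ : [set x | _] = setT `&` affine p @^-1` `]0, +oo[).
  exact: measurable_affine.
by rewrite setTI preimage_itvoy.
Qed.

Lemma measurable_affine_ge0 (p : plane R * R) :
  measurable ([set x | 0 <= affine p x] : set mplane).
Proof.
rewrite (_ : [set x | _] = setT `&` affine p @^-1` `[0, +oo[).
  exact: measurable_affine.
by rewrite setTI preimage_itvcy.
Qed.

Lemma measurable_affine_line (p : plane R * R) :
  measurable ([set x | affine p x = 0] : set mplane).
Proof.
rewrite (_ : [set x | _] = setT `&` affine p @^-1` [set 0]).
  exact: measurable_affine.
by rewrite setTI.
Qed.

(** A vertical line is a point times the real line; any other line has one-point sections. *)
Lemma lebesgue2_line (p : plane R * R) : p.1 != 0 ->
  mu2 ([set x | affine p x = 0]) = 0%E.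
Proof.
move=> p0.
have [p2|p2] := eqVneq p.1.2 0.
  have p1 : p.1.1 != 0.
    by apply: contra_neq p0 => p1; apply: plane_eq.
  rewrite (_ : [set x | _] = [set - p.2 / p.1.1] `*` setT).
    by rewrite lebesgue2E// lebesgue_measure_set1 mul0e.
  apply/seteqP; split => x /=; rewrite /affine /dot p2 mul0r addr0.
    by move=> h; split => //; apply: (mulfI p1); rewrite mulrCA divff// mulr1; lra.
  by move=> [-> _]; field.
rewrite /lebesgue2 /product_measure1 integral0_eq// => x _ /=.
rewrite (_ : xsection _ _ = [set - (p.1.1 * x + p.2) / p.1.2]).
  exact: lebesgue_measure_set1.
apply/seteqP; split => y; rewrite /xsection /= inE /= /affine /dot /=.
  by move=> h; apply: (mulfI p2); rewrite mulrCA divff// mulr1; lra.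
by move=> ->; field.
Qed.

(** One null set for a whole family of lines: the sides of the triangle in [lebesgue2_hull], its
    mid-lines in [int_split]. *)
Lemma lebesgue2_lines (I : finType) (T : {set I}) (p : I -> plane R * R) :
  (forall i, i \in T -> (p i).1 != 0) ->
  exists N : set mplane, [/\ measurable N, mu2 N = 0%E &
    forall x i, i \in T -> affine (p i) x = 0 -> N x].
Proof.
move=> p0; pose N : set mplane :=
  \bigcup_(i in [set` enum T]) [set x | affine (p i) x = 0].
suff [mN N0] : measurable N /\ mu2 N = 0%E.
  by exists N; split => // x i iT px; exists i => //=; rewrite mem_enum.
rewrite /N bigcup_seq big_enum /=.
apply: (big_ind (fun A : set mplane => measurable A /\ mu2 A = 0%E)).
- by split; [exact: measurable0|exact: measure0].
- move=> A B [mA A0] [mB B0]; split; first exact: measurableU.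
  exact: etrans (measureU0 mA mB B0) A0.
- by move=> i iT; split; [exact: measurable_affine_line|exact/lebesgue2_line/p0].
Qed.

Context (Th : mesh R) (T : {set vertex Th}).
Hypotheses (T3 : #|T| = 3) (Tind : affinely_independent T).
Local Notation U := (hull T)°.

Lemma bary_coef_neq0 i : i \in T -> (bary_coef T i).1 != 0.
Proof.
move=> iT; apply/eqP => b0.
have [j jT ji] := card3_other i T3.
have := bary_coord T3 Tind iT jT; have := bary_coord T3 Tind iT iT.
rewrite /bary /affine b0 /dot /= !mul0r !add0r eqxx eq_sym (negPf ji) => -> /eqP.
by rewrite oner_eq0.
Qed.

Lemma measurable_interior_hull : measurable (U : set mplane).
Proof.
rewrite (_ : U = \bigcap_(i in [set` T]) [set x | 0 < affine (bary_coef T i) x]).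
  apply: fin_bigcap_measurable => // i _.
  exact: measurable_affine_gt0.
apply/seteqP; split=> x; first by move=> /(interior_hullP T3 Tind) xU i /xU.
by move=> xU; apply/(interior_hullP T3 Tind) => i iT; exact: xU.
Qed.

Lemma interior_bary_le1 i x : U x -> i \in T -> bary T i x <= 1.
Proof.
move=> /(interior_hullP T3 Tind) xU iT.
rewrite -(bary_sum T3 Tind x) (bigD1 i)//= lerDl sumr_ge0// => j /andP[jT _].
exact/ltW/xU.
Qed.

Lemma interior_hull_bounded p : exists M, forall x, U x -> `|affine p x| <= M.
Proof.
exists (\sum_(i in T) `|affine p (coord i)|) => x /(interior_hullP T3 Tind) xU.
rewrite (affine_bary T3 Tind p x).
apply: le_trans (ler_norm_sum _ _ _) _; apply: ler_sum => i iT.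
rewrite normrM -[leRHS]mul1r ler_wpM2r// gtr0_norm ?xU//.
by rewrite interior_bary_le1//; apply/(interior_hullP T3 Tind).
Qed.

Lemma lebesgue2_interior_lty : (mu2 U < +oo)%E.
Proof.
have [M1 h1] := interior_hull_bounded ((1, 0), 0).
have [M2 h2] := interior_hull_bounded ((0, 1), 0).
apply: (@le_lt_trans _ _ (mu2 (`[- M1, M1] `*` `[- M2, M2]))).
  apply: le_measure; rewrite ?inE;
    [exact: measurable_interior_hull|exact: measurableX|].
  move=> x xU; have := h1 x xU; have := h2 x xU.
  rewrite /affine /dot /= mul1r !mul0r mul1r !addr0 add0r !ler_norml => x2 x1.
  by split; rewrite /= in_itv.
rewrite lebesgue2E// !lebesgue_measure_itv/=.
by do 2 case: ifP => _; rewrite ?mule0 ?mul0e ?ltry// -!EFinD -EFinM ltry.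
Qed.

Lemma lebesgue2_interior_gt0 : (0 < mu2 U)%E.
Proof.
(* The centroid is interior, and a product neighbourhood of it contains an open rectangle. *)
pose c := \sum_(i in T) 3^-1 *: coord i.
have cU : U c.
  apply/(interior_hullP T3 Tind) => i iT.
  rewrite -(bary_uniq T3 Tind (l := fun=> 3^-1) (x := c))//.
  by rewrite sumr_const T3 /=; lra.
have : nbhs c U by apply: open_nbhs_nbhs; split => //; exact: open_interior.
move=> [[A B] /= [/nbhs_ballP[e1 /= e10 eA] /nbhs_ballP[e2 /= e20 eB]] AB].
apply: (@lt_le_trans _ _ (mu2 (ball c.1 e1 `*` ball c.2 e2))).
  rewrite lebesgue2E; try exact: measurable_ball.
  rewrite !lebesgue_measure_ball ?ltW// -EFinM lte_fin mulr_gt0// mulrn_wgt0//.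
apply: le_measure; rewrite ?inE; [|exact: measurable_interior_hull|].
  by apply: measurableX; exact: measurable_ball.
by move=> x [x1 x2]; apply: AB; split; [exact: eA|exact: eB].
Qed.

Lemma measurable_hull : measurable (hull T : set mplane).
Proof.
rewrite (_ : hull T = \bigcap_(i in [set: vertex Th])
  [set x | 0 <= affine (bary_coef T i) x]).
  by apply: fin_bigcap_measurable => // i _; exact: measurable_affine_ge0.
apply/seteqP; split=> x; first by move=> /(hullP T3 Tind) xU i _; exact: xU.
by move=> xU; apply/(hullP T3 Tind) => i; exact: xU.
Qed.

(** A point of the closed triangle that is not interior lies on one of the side lines, which are
    null. *)
Lemma lebesgue2_hull : mu2 (hull T) = mu2 U.
Proof.
have [N [mN N0 hN]] := lebesgue2_lines bary_coef_neq0.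
have mU := measurable_interior_hull; have mH := measurable_hull.
apply/eqP; rewrite eq_le; apply/andP; split; last first.
  by apply: le_measure; rewrite ?inE//; exact: interior_subset.
rewrite -(measureU0 mU mN N0 : mu2 (U `|` N) = mu2 U).
apply: le_measure; rewrite ?inE//; first exact: measurableU.
move=> x /(hullP T3 Tind) xT.
have [xN|xN] := pselect (exists2 i, i \in T & bary T i x = 0).
  by right; case: xN => i iT; exact: hN.
left; apply/(interior_hullP T3 Tind) => i iT; rewrite lt_neqAle xT andbT eq_sym.
by apply/eqP => x0; apply: xN; exists i.
Qed.

Lemma integrable_affine p : mu2.-integrable U (EFin \o (affine p : mplane -> R)).
Proof.
have [M hM] := interior_hull_bounded p.
apply: measurable_bounded_integrable.
- exact: measurable_interior_hull.
- exact: lebesgue2_interior_lty.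
- exact: measurable_affine.
- exists M; split; first exact: num_real.
  by move=> M' /ltW MM' x xU; exact: le_trans (hM x xU) MM'.
Qed.

(** The measure and the first moments of [U] determine the integral of every affine function. *)
Let s := fine (mu2 U).
Let m : plane R := (\int[mu2]_(x in U) x.1, \int[mu2]_(x in U) x.2).

Let integral_affine0 p : \int[mu2]_(x in U) affine p x = dot p.1 m + p.2 * s.
Proof.
have mU := measurable_interior_hull.
have i1 : mu2.-integrable U (EFin \o (fun x : mplane => x.1)).
  have := integrable_affine ((1, 0), 0).
  by rewrite /affine /dot /=; under eq_fun do rewrite mul1r mul0r !addr0.
have i2 : mu2.-integrable U (EFin \o (fun x : mplane => x.2)).
  have := integrable_affine ((0, 1), 0).
  by rewrite /affine /dot /=; under eq_fun do rewrite mul1r mul0r add0r addr0.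
have ic (c : R) : mu2.-integrable U (EFin \o cst c).
  have := integrable_affine ((0, 0), c).
  by rewrite /affine /dot /=; under eq_fun do rewrite !mul0r !add0r.
rewrite /affine /dot RintegralD//; last 2 first.
- by have := integrable_affine (p.1, 0); rewrite /affine /dot;
  under eq_fun do rewrite addr0.
- exact: ic.
rewrite Rintegral_cst//; congr (_ + _).
rewrite RintegralD//; last 2 first.
- have := integrable_affine ((p.1.1, 0), 0).
  by rewrite /affine /dot /=; under eq_fun do rewrite mul0r !addr0.
- have := integrable_affine ((0, p.1.2), 0).
  by rewrite /affine /dot /=; under eq_fun do rewrite mul0r add0r !addr0.
by rewrite !RintegralZl.
Qed.

(** Extension by zero, since [integral_homothety] concerns integrals over the whole plane. *)
Let G p (x : mplane) : \bar R := ((EFin \o affine p) \_ U) x.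

Let measurable_G p : measurable_fun setT (G p).
Proof.
have /(measurable_restrictT _ measurable_interior_hull) : measurable_fun
  (U : set mplane) (EFin \o affine p : mplane -> \bar R).
  by apply/measurable_EFinP; exact: measurable_affine.
by [].
Qed.

Let G_ge0 p : (forall x, U x -> 0 <= affine p x) -> forall x, (0 <= G p x)%E.
Proof.
by move=> p0 x; rewrite /G /patch; case: ifP => //; rewrite inE => /p0;
  rewrite lee_fin.
Qed.

Let integral_G p : (\int[mu2]_x G p x)%E = (dot p.1 m + p.2 * s)%:E.
Proof.
rewrite -integral_affine0 /Rintegral fineK; last first.
  apply: integrable_fin_num; first exact: measurable_interior_hull.
  exact: integrable_affine.
have E := @integral_mkcond _ _ _ mu2 (U : set mplane) (EFin \o (affine p : mplane ->
  R)).
exact: esym E.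
Qed.

Let integral_G_homothety c v p : c != 0 -> (forall x, U x -> 0 <= affine p x) ->
  (\int[mu2]_x G p (homothety c v x) = ((c ^+ 2)^-1 * (dot p.1 m + p.2 * s))%:E)%E.
Proof.
move=> c0 p0; rewrite EFinM -integral_G.
rewrite (@integral_homothety R c v (G p) c0 (measurable_G p) (G_ge0 p0)).
rewrite muleA -EFinM mulVf ?mul1e//.
by rewrite expf_neq0.
Qed.

(* The midpoints of the sides cut the triangle into four triangles, which the
   dilations [x |-> 2 x - a_j] and the reflection [x |-> a_1 + a_2 + a_3 - 2 x]
   map onto the whole triangle. *)
Let dilation (j : vertex Th) : mplane -> mplane := homothety 2 (- coord j).
Let reflection : mplane -> mplane := homothety (- 2) (\sum_(j in T) coord j).

Let bary_dilation i j x : i \in T -> j \in T ->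
  bary T i (dilation j x) = 2 * bary T i x - (i == j)%:R.
Proof.
move=> iT jT; rewrite -(bary_coord T3 Tind iT jT).
by rewrite /bary /affine /dilation /reflection /homothety /dot /=; ring.
Qed.

Let bary_reflection i x : i \in T ->
  bary T i (reflection x) = 1 - 2 * bary T i x.
Proof.
move=> iT.
have E : 1 = \sum_(j in T) bary T i (coord j).
  rewrite (bigD1 i)//= (bary_coord T3 Tind iT iT) eqxx big1 ?addr0// =>
    j /andP[jT ji].
  by rewrite (bary_coord T3 Tind iT jT) eq_sym (negPf ji).
have [p [q [r [_ _ _ _ sumT]]]] := card3_split T3.
rewrite sumT in E; rewrite /reflection sumT [X in X - _]E.
by rewrite /bary /affine /dilation /reflection /homothety /dot /=; ring.
Qed.

Let interior_dilation j x : j \in T ->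
  U (dilation j x) <->
  2^-1 < bary T j x /\ forall i, i \in T -> i != j -> 0 < bary T i x.
Proof.
move=> jT; split=> [/(interior_hullP T3 Tind) h|[hj hi]].
  split; first by have := h j jT; rewrite bary_dilation// eqxx /=; lra.
  by move=> i iT ij; have := h i iT; rewrite bary_dilation// (negPf ij) /=; lra.
apply/(interior_hullP T3 Tind) => i iT; rewrite bary_dilation//.
have [->|ij] := eqVneq i j; rewrite /=; first by lra.
by have := hi i iT ij; lra.
Qed.

Let interior_reflection x :
  U (reflection x) <->
  forall i, i \in T -> bary T i x < 2^-1.
Proof.
split=> [/(interior_hullP T3 Tind) h i iT|h].
  by have := h i iT; rewrite bary_reflection//; lra.
apply/(interior_hullP T3 Tind) => i iT; rewrite bary_reflection//.
by have := h i iT; lra.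
Qed.

(** Chosen so that [half i (i == j)%:R] after [dilation j], and [half' i] after [reflection], both
    give back [bary T i]. *)
Let half i c : plane R * R :=
  (2^-1 *: (bary_coef T i).1, 2^-1 * ((bary_coef T i).2 + c)).
Let half' i : plane R * R :=
  (- 2^-1 *: (bary_coef T i).1, 2^-1 * (1 - (bary_coef T i).2)).

Let halfE i c x : affine (half i c) x = 2^-1 * (bary T i x + c).
Proof. by rewrite /bary /affine /dot /= !planeE; ring. Qed.

Let half'E i x : affine (half' i) x = 2^-1 * (1 - bary T i x).
Proof. by rewrite /bary /affine /dot /= !planeE; ring. Qed.

Let G_out p x : ~ U x -> G p x = 0%E.
Proof. by move=> xU; rewrite /G /patch; case: ifP => //; rewrite inE. Qed.

Let G_in p x : U x -> G p x = (affine p x)%:E.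
Proof. by move=> xU; rewrite /G /patch mem_set. Qed.

(** Off the mid-lines, a point of [U] has either exactly one coordinate above 1/2 (a corner
    triangle) or all of them below (the central one), so exactly one term survives. A point outside
    [U] is in none of the four, as three numbers below 1/2 with sum 1 are positive. *)
Let G_split i x : i \in T -> (forall j, j \in T -> bary T j x != 2^-1) ->
  G (bary_coef T i) x =
  (\sum_(j in T) G (half i (i == j)%:R) (dilation j x) +
   G (half' i) (reflection x))%E.
Proof.
move=> iT xN.
have Gd j : j \in T -> U (dilation j x) ->
    G (half i (i == j)%:R) (dilation j x) = (bary T i x)%:E.
  by move=> jT xU; rewrite G_in// halfE bary_dilation//; congr EFin; field.
have Gr : U (reflection x) ->
    G (half' i) (reflection x) = (bary T i x)%:E.
  by move=> xU; rewrite G_in// half'E bary_reflection//; congr EFin; field.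
have b1 := bary_sum T3 Tind x.
have [xU|xU] := pselect (U x); last first.
  rewrite G_out// G_out ?big1 ?adde0//.
    move=> j jT; rewrite G_out// => /(interior_dilation _ jT)[h1 h2].
    apply: xU; apply/(interior_hullP T3 Tind) => k kT.
    by have [->|kj] := eqVneq k j; [lra|exact: h2].
  move/interior_reflection => h; apply: xU; apply/(interior_hullP T3 Tind) => k.
  have [p [q [r [_ _ _ defT sumT]]]] := card3_split T3.
  have [hp hq hr] : [/\ bary T p x < 2^-1, bary T q x < 2^-1 & bary T r x < 2^-1].
    by split; apply: h; rewrite defT !inE eqxx ?orbT.
  rewrite sumT in b1.
  by rewrite [in X in is_true X -> _]defT !inE => /orP[/orP[]|] /eqP->; lra.
have b0 := (proj1 (interior_hullP T3 Tind x) xU).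
rewrite (G_in _ xU).
have [[j jT hj]|hn] := pselect (exists2 j, j \in T & 2^-1 < bary T j x).
  have Uj : U (dilation j x).
    by apply/(interior_dilation _ jT); split => // k kT _; exact: b0.
  rewrite [X in (_ + X)%E]G_out ?adde0; last first.
    by move=> /interior_reflection/(_ j jT); lra.
  rewrite (bigD1 j)//= Gd// big1 ?adde0// => k /andP[kT kj].
  rewrite G_out// => /(interior_dilation _ kT)[h _].
  (* Two coordinates above 1/2 would push the sum of the coordinates beyond 1. *)
  move: b1; rewrite (bigD1 j)//= (bigD1 k)/=; last by rewrite kT.
  set z := \sum_(_ | _) _; have : 0 <= z.
    by apply: sumr_ge0 => l /andP[/andP[lT _] _]; exact/ltW/b0.
  by clear Gd Gr => ? ?; lra.
rewrite big1 ?add0e; last first.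
  by move=> j jT; rewrite G_out// => /(interior_dilation _ jT)[h _]; apply: hn;
    exists j.
rewrite Gr//; apply/interior_reflection => k kT.
rewrite lt_neqAle xN//= leNgt; apply/negP => h; apply: hn.
by exists k.
Qed.

Let int p := dot p.1 m + p.2 * s.

(** Integration of [G_split]: the excluded mid-lines are null and each homothety contributes a
    factor 1/4. *)
Let int_split i : i \in T ->
  int (bary_coef T i) =
  2^-1 ^+ 2 * (\sum_(j in T) int (half i (i == j)%:R) + int (half' i)).
Proof.
move=> iT; apply: EFin_inj; rewrite /int -integral_G.
have [N [mN N0 hN]] := @lebesgue2_lines _ T (fun i =>
  ((bary_coef T i).1, (bary_coef T i).2 - 2^-1)) bary_coef_neq0.
have b01 x k : U x -> k \in T -> 0 <= bary T k x <= 1.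
  move=> xU kT; rewrite interior_bary_le1// andbT ltW//.
  by have /(interior_hullP T3 Tind) := xU; apply.
have half_ge0 j x : U x -> 0 <= affine (half i (i == j)%:R) x.
  by move=> /b01/(_ iT)/andP[b0 _]; rewrite halfE mulr_ge0// addr_ge0.
have half'_ge0 x : U x -> 0 <= affine (half' i) x.
  by move=> /b01/(_ iT)/andP[_ b0]; rewrite half'E mulr_ge0// subr_ge0.
have c2 : (2 : R) != 0 by [].
have c2' : (- 2 : R) != 0 by rewrite oppr_eq0.
have mGd j : measurable_fun setT (fun x => G (half i (i == j)%:R) (dilation j x)).
  exact: measurableT_comp (measurable_G _) (measurable_homothety _ _).
have mGr : measurable_fun setT (fun x => G (half' i) (reflection x)).
  exact: measurableT_comp (measurable_G _) (measurable_homothety _ _).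
rewrite (@ae_eq_integral _ _ _ mu2 setT (fun x =>
  (\sum_(j <- enum T) G (half i (i == j)%:R) (dilation j x) +
   G (half' i) (reflection x))%E) (G (bary_coef T i)) measurableT (measurable_G _));
     last 2 first.
- apply: emeasurable_funD => //; exact: emeasurable_sum.
- exists N; split => // x /= /not_implyP[_ hx]; apply: contrapT => xN.
  apply: hx; rewrite big_enum; apply: G_split => // j jT; apply/eqP => bj; apply: xN;
    apply: (hN _ j jT).
  by move: bj; rewrite /bary /affine /=; lra.
rewrite ge0_integralD//; last 3 first.
- by move=> x _; apply: sume_ge0 => j _; apply: G_ge0; exact: half_ge0.
- exact: emeasurable_sum.
- by move=> x _; exact: G_ge0.
rewrite (integral_G_homothety _ c2' half'_ge0).
rewrite ge0_integral_sum//; last first.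
  by move=> j x _; apply: G_ge0; exact: half_ge0.
under eq_bigr do rewrite (integral_G_homothety _ c2 (half_ge0 _)).
rewrite sumEFin big_enum -EFinD; congr EFin.
rewrite [RHS]mulrDr mulr_sumr; congr (_ + _).
  by apply: eq_bigr => j _; rewrite exprVn.
by rewrite sqrrN exprVn.
Qed.

Lemma area_gt0 : 0 < area T.
Proof.
rewrite /area lebesgue2_hull; apply: fine_gt0.
by rewrite lebesgue2_interior_gt0 lebesgue2_interior_lty.
Qed.

Lemma Rintegral_interior_hull p :
  \int[mu2]_(x in U) affine p x = area T / 3 * \sum_(i in T) affine p (coord i).
Proof.
have sE : area T = s by rewrite /area lebesgue2_hull.
have s0 : s != 0 by rewrite -sE gt_eqF// area_gt0.
(* The integral is [s] times the value at [s^-1 *: m], so only the barycentric coordinates of that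
   point remain to be found. *)
have intE q : int q = s * affine q (s^-1 *: m).
  by rewrite /int /affine /dot !planeE; field.
(* With [J = int (bary_coef T i)], the identity [int_split] reads [J = (J + s) / 4]. *)
have int_bary i : i \in T -> int (bary_coef T i) = s / 3.
  move=> iT; have := int_split iT.
  have halfI c : int (half i c) = 2^-1 * (int (bary_coef T i) + c * s).
    by rewrite /int /half /dot /= !planeE; ring.
  have -> : int (half' i) = 2^-1 * (s - int (bary_coef T i)).
    by rewrite /int /half' /dot /= !planeE; ring.
  under eq_bigr do rewrite halfI.
  rewrite -mulr_sumr big_split/= -mulr_suml sumr_const T3.
  rewrite [X in X * s](bigD1 i)//= eqxx [X in 1 + X]big1; last first.
    by move=> j /andP[_]; rewrite eq_sym => /negPf->.
  by set J := int _; move=> E; lra.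
rewrite integral_affine0 -/(int p) intE (affine_bary T3 Tind) !mulr_sumr sE.
by apply: eq_bigr => i iT; rewrite mulrA -intE int_bary.
Qed.

End TriangleMeasure.

(** * Triangles sharing a vertex or an edge *)

Lemma card3_third (I : finType) (T : {set I}) M A : #|T| = 3 -> M \in T -> A \in T ->
  M != A -> exists B, [/\ B != M, B != A, T = [set M; A; B]%SET &
    forall (V : nmodType) (F : I -> V), \sum_(i in T) F i = F M + F A + F B].
Proof.
move=> T3 MT AT MA.
have : #|T :\ M :\ A| = 1.
  have E : #|T :\ M| = 2%N by have := cardsD1 M T; rewrite MT T3 => -[].
  by have := cardsD1 A (T :\ M); rewrite !inE AT eq_sym MA E => -[].
move=> /eqP/cards1P[B TB].
have : B \in T :\ M :\ A by rewrite TB set11.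
rewrite !inE => /and3P[BA BM BT].
have defT : T = [set M; A; B]%SET.
  apply/setP => i; rewrite !inE.
  have := congr1 (fun S : {set I} => i \in S) TB; rewrite !inE.
  have [->|iM] := eqVneq i M; first by rewrite MT.
  have [->|iA] := eqVneq i A; first by rewrite AT.
  by [].
exists B; split => // V F.
rewrite (bigD1 M)//= (bigD1 A)/=; last by rewrite AT eq_sym.
rewrite (bigD1 B)/=; last by rewrite BT BM BA.
rewrite big1 ?addr0 ?addrA// => i.
by rewrite defT !inE -andbA -andbA => /and4P[/orP[/orP[]|] /eqP->]; rewrite ?eqxx.
Qed.

Section Triangulation.
Context (R : realType) (Omega : set (plane R)) (Th : mesh R).
Hypothesis (tri : is_triangulation Th Omega).
Implicit Types (T S : {set vertex Th}) (M A B : vertex Th).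

Lemma cell_card T : T \in cells Th -> #|T| = 3.
Proof. exact: tri_card tri T. Qed.

Lemma cell_ind T : T \in cells Th -> affinely_independent T.
Proof. exact: tri_nondegenerate tri T. Qed.

(** Weights on a face, extended by zero, are weights on the cell; [bary_uniq] identifies them. *)
Lemma bary_sub T S (l : vertex Th -> R) x : T \in cells Th -> S \subset T ->
  \sum_(i in S) l i = 1 -> x = \sum_(i in S) l i *: coord i ->
  forall i, bary T i x = if i \in S then l i else 0.
Proof.
move=> cT ST l1 lx i.
have [iT|iT] := boolP (i \in T); last first.
  rewrite bary_out//; [|exact: cell_card|exact: cell_ind].
  by case: ifP => // /(fintype.subsetP ST); rewrite (negPf iT).
symmetry; apply: (bary_uniq (cell_card cT) (cell_ind cT) (l := fun i =>
  if i \in S then l i else 0)) => //.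
  rewrite -l1 -big_mkcondr /=; apply: eq_bigl => j.
  by have := fintype.subsetP ST j; case: (j \in S); case: (j \in T) => // /(_ isT).
rewrite lx [RHS](eq_bigr (fun i => if i \in S then l i *: coord i else 0));
  last first.
  by move=> j _; case: ifP; rewrite ?scale0r.
rewrite -big_mkcondr /=; apply: eq_bigl => j.
by have := fintype.subsetP ST j; case: (j \in S); case: (j \in T) => // /(_ isT).
Qed.

(** Conformity puts a common point in the hull of the common vertices, where the same weights serve
    both cells. *)
Lemma bary_common T T' x i : T \in cells Th -> T' \in cells Th ->
  hull T x -> hull T' x -> bary T i x = bary T' i x.
Proof.
move=> cT cT' xT xT'; have [<-//|TT'] := eqVneq T T'.
have : (hull T `&` hull T') x by [].
rewrite (tri_conforming tri cT cT' TT') => -[l [_ l1 lx]].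
rewrite (bary_sub cT (finset.subsetIl _ _) l1 lx).
by rewrite (bary_sub cT' (finset.subsetIr _ _) l1 lx).
Qed.

Lemma cell_subset T T' : T \in cells Th -> T' \in cells Th -> T \subset T' -> T = T'.
Proof.
by move=> cT cT' TT'; apply/eqP; rewrite eqEcard TT' !cell_card.
Qed.

(** The coordinates in [T] are positive and agree with those in [T'], so every vertex of [T] is one
    of [T']. *)
Lemma interior_hull_eq T T' x : T \in cells Th -> T' \in cells Th ->
  (hull T)° x -> hull T' x -> T = T'.
Proof.
move=> cT cT' xT xT'; apply: cell_subset => //; apply/fintype.subsetP => i iT.
apply/negPn/negP => iT'.
have /(interior_hullP (cell_card cT) (cell_ind cT))/(_ i iT) := xT.
rewrite (bary_common i cT cT' (interior_subset xT) xT').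
by rewrite bary_out ?ltxx//; [exact: cell_card|exact: cell_ind].
Qed.

(** The closed angular sector of [T] at [M], continued beyond the opposite side. *)
Definition cone M T (x : plane R) := forall i, i != M -> 0 <= bary T i x.

(** A contraction towards [M] multiplies these coordinates by one factor and brings [x] into both
    triangles, where [bary_common] applies. *)
Lemma cone_common M T T' x i : T \in cells Th -> T' \in cells Th ->
  M \in T -> M \in T' -> cone M T x -> cone M T' x -> i != M ->
  bary T i x = bary T' i x.
Proof.
move=> cT cT' MT MT' xT xT' iM.
have [T3 Ti] := (cell_card cT, cell_ind cT).
have [T'3 T'i] := (cell_card cT', cell_ind cT').
(* Small enough that the coordinate [1 - e + e * b] of [y] at [M] is nonnegative for both values [b]
   of the coordinate of [x]. *)
pose e := (1 + `|bary T M x| + `|bary T' M x|)^-1.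
have e0 : 0 < e by rewrite invr_gt0 -addrA ltr_wpDr// addr_ge0.
pose y := (1 - e) *: coord M + e *: x.
have shrink S (S3 : #|S| = 3) (Si : affinely_independent S) : M \in S -> cone M S x ->
    `|bary S M x| <= `|bary T M x| + `|bary T' M x| ->
    hull S y /\ forall j, j != M -> bary S j y = e * bary S j x.
  move=> MS xS bS.
  have E j : j != M -> bary S j y = e * bary S j x.
    move=> jM; rewrite /y /bary affine_conv.
    have [jS|jS] := boolP (j \in S).
      by rewrite -/(bary S j _) (bary_coord S3 Si jS MS) (negPf jM) mulr0 add0r.
    by rewrite -!/(bary S j _) !bary_out// !mulr0 addr0.
  split => //; apply/(hullP S3 Si) => j.
  have [->|jM] := eqVneq j M; last by rewrite E// mulr_ge0 ?(ltW e0)// xS.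
  rewrite /y /bary affine_conv -!/(bary S M _) (bary_coord S3 Si MS MS) eqxx mulr1.
  have : e * (1 + `|bary S M x|) <= 1.
    by rewrite mulrC ler_pdivrMr ?mul1r -?addrA ?lerD2l// ltr_wpDr// addr_ge0.
  have := ler_norm (- bary S M x); rewrite normrN => h1 h2.
  have : e * (- bary S M x) <= e * `|bary S M x| by rewrite ler_pM2l.
  by lra.
have [yT ET] := shrink T T3 Ti MT xT (ltac:(by rewrite lerDl)).
have [yT' ET'] := shrink T' T'3 T'i MT' xT' (ltac:(by rewrite lerDr)).
by apply: (mulfI (lt0r_neq0 e0)); rewrite -ET// -ET'//; exact: bary_common.
Qed.

(** The affine function [bary T B] vanishes at [M] and [A], hence is a multiple of [bary T' B']. The
    negative factor says that the two cells lie on opposite sides of their common edge. *)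
Lemma wedge_opposite T T' M A B B' : T \in cells Th -> T' \in cells Th -> T != T' ->
  T = [set M; A; B]%SET -> T' = [set M; A; B']%SET ->
  M != A -> B != M -> B != A -> B' != M -> B' != A ->
  bary T B (coord B') < 0 /\
  forall x, bary T B x = bary T' B' x * bary T B (coord B').
Proof.
move=> cT cT' TT' eT eT' MA BM BA B'M B'A.
have [T3 Ti] := (cell_card cT, cell_ind cT).
have [T'3 T'i] := (cell_card cT', cell_ind cT').
have [MT AT BT] : [/\ M \in T, A \in T & B \in T] by rewrite eT !inE !eqxx ?orbT.
have [MT' AT' BT'] : [/\ M \in T', A \in T' & B' \in T']
  by rewrite eT' !inE !eqxx ?orbT.
have [C [CM CA eC sumT']] := card3_third T'3 MT' AT' MA.
have {eC} CB' : C = B'.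
  have : C \in [set M; A; B']%SET by rewrite -eT' eC !inE eqxx ?orbT.
  by rewrite !inE (negPf CM) (negPf CA) => /eqP.
subst C.
split; last first.
  move=> x; rewrite [LHS](affine_bary T'3 T'i) sumT' -!/(bary T B _).
  rewrite (bary_coord T3 Ti BT MT) (bary_coord T3 Ti BT AT) (negPf BM) (negPf BA).
  by rewrite !mulr0 !add0r.
(* If [B'] were on the side of [B], moving it far along the edge from [M] to [A]
   would put it in both cones. *)
rewrite ltNge; apply/negP => k0.
(* This multiple makes the coordinate of [x] at [A] in [T] nonnegative. *)
pose K := `|bary T A (coord B')|.
pose x := coord B' + K *: (coord A - coord M).
have bx S j : bary S j x
  = bary S j (coord B') + K * (bary S j (coord A) - bary S j (coord M)).
  by rewrite /x /bary /affine /dot /= !planeE /=; ring.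
have xT : cone M T x.
  move=> j jM; have [jT|jT] := boolP (j \in T); last by rewrite bary_out.
  rewrite bx (bary_coord T3 Ti jT AT) (bary_coord T3 Ti jT MT) (negPf jM) subr0.
  move: jT; rewrite [in X in is_true X -> _]eT !inE (negPf jM) => /orP[]/eqP->.
    by rewrite eqxx mulr1; have := ler_norm (- bary T A (coord B'));
      rewrite normrN /K; lra.
  by rewrite (negPf BA) mulr0 addr0.
have xT' : cone M T' x.
  move=> j jM; have [jT|jT] := boolP (j \in T'); last by rewrite bary_out.
  rewrite bx !(bary_coord T'3 T'i jT)// (negPf jM) subr0.
  by rewrite addr_ge0 ?mulr_ge0 ?ler0n ?/K ?normr_ge0.
(* The common coordinate at [B'] is 1, so [B'] is a vertex of [T] and the cells coincide. *)
have := cone_common cT cT' MT MT' xT xT' B'M.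
rewrite [RHS]bx !(bary_coord T'3 T'i BT')// eqxx (negPf B'A) (negPf B'M) subrr mulr0
  addr0.
have [B'T|B'T] := boolP (B' \in T); last first.
  by rewrite bary_out// => /eqP; rewrite eq_sym oner_eq0.
move=> _; move: B'T TT';
  rewrite eT' [in X in X -> _]eT !inE (negPf B'M) (negPf B'A) /=.
by move=> /eqP->; rewrite eT eqxx.
Qed.

(** Three distinct cells on an edge would be pairwise on opposite sides of it, but a product of two
    negative factors is not negative. *)
Lemma edge_cells_le2 T T' T'' M A : T \in cells Th -> T' \in cells Th ->
  T'' \in cells Th -> M != A ->
  M \in T -> A \in T -> M \in T' -> A \in T' -> M \in T'' -> A \in T'' ->
  [\/ T = T', T = T'' | T' = T''].
Proof.
move=> c c' c'' MA MT AT MT' AT' MT'' AT''.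
have [->|n1] := eqVneq T T'; first by constructor 1.
have [->|n2] := eqVneq T T''; first by constructor 2.
have [->|n3] := eqVneq T' T''; first by constructor 3.
have [B [BM BA eT _]] := card3_third (cell_card c) MT AT MA.
have [B' [B'M B'A eT' _]] := card3_third (cell_card c') MT' AT' MA.
have [B'' [B''M B''A eT'' _]] := card3_third (cell_card c'') MT'' AT'' MA.
have [k1 E1] := wedge_opposite c c' n1 eT eT' MA BM BA B'M B'A.
have [k2 E2] := wedge_opposite c' c'' n3 eT' eT'' MA B'M B'A B''M B''A.
have [k3 E3] := wedge_opposite c c'' n2 eT eT'' MA BM BA B''M B''A.
by move: k3; rewrite E1 ltNge mulr_le0// ltW.
Qed.

End Triangulation.

(** * Hat functions and the frontier *)

Section Boundary.
Context (R : realType) (Omega : set (plane R)) (Th : mesh R).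
Hypotheses (pol : polygon Omega) (tri : is_triangulation Th Omega).
Implicit Types (T S : {set vertex Th}) (M A B : vertex Th).

Let c3 T : T \in cells Th -> #|T| = 3 := @cell_card R Omega Th tri T.
Let ci T : T \in cells Th -> affinely_independent T := @cell_ind R Omega Th tri T.

(** * The domain, its closure and its frontier in terms of cells *)

Lemma polygon_open : open Omega.
Proof. by case: pol. Qed.

Lemma frontierP x : frontier Omega x <-> closure Omega x /\ ~ Omega x.
Proof.
by rewrite /frontier (interior_id Omega).1//; exact: polygon_open.
Qed.

Lemma hull_closure T x : T \in cells Th -> hull T x -> closure Omega x.
Proof. by move=> cT xT; rewrite -(tri_cover tri); exists T. Qed.

Lemma closure_hull x : closure Omega x -> exists2 T, T \in cells Th & hull T x.
Proof. by rewrite -(tri_cover tri) => -[T]; exists T. Qed.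

Lemma near_closure_interior x : nbhs x (closure Omega) -> Omega x.
Proof. by case: pol => _ _ _ E _ h; rewrite -E. Qed.

Lemma closure_interior x : Omega x -> nbhs x (closure Omega).
Proof.
move=> Ox; apply: filterS (@subset_closure _ Omega) _.
by apply: open_nbhs_nbhs; split => //; exact: polygon_open.
Qed.

Lemma hull_coord T M : T \in cells Th -> M \in T -> hull T (coord M).
Proof.
move=> cT MT; apply/(hullP (c3 cT) (ci cT)) => i.
have [iT|iT] := boolP (i \in T); last by rewrite (bary_out (c3 cT) (ci cT)).
by rewrite (bary_coord (c3 cT) (ci cT)).
Qed.

Lemma vertex_interior_or_boundary M : interior_vertex Omega M
  = ~~ boundary_vertex Omega M.
Proof.
have [T cT MT] := tri_vertex tri M.
have MO := hull_closure cT (hull_coord cT MT).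
apply/idP/idP => [/asboolP OM|/asboolP nM].
  by apply/asboolP => /frontierP[].
by apply/asboolP; apply: contrapT => OM; apply: nM; apply/frontierP.
Qed.

(** The finitely many closed hulls that miss [x] also miss a neighbourhood of it. *)
Lemma near_hulls x : \forall y \near x, forall T, T \in cells Th -> hull T y ->
  hull T x.
Proof.
apply: (@filter_forall _ _ (fun T y => T \in cells Th -> hull T y ->
  hull T x) (nbhs x)) => T.
have [cT|cT] := boolP (T \in cells Th); last by apply: nearW.
have [xT|xT] := pselect (hull T x); first by apply: nearW.
have : nbhs x (~` hull T).
  by apply: open_nbhs_nbhs; split => //;
    exact/closed_openC/(closed_hull (c3 cT) (ci cT)).
by apply: filterS => y yT _.
Qed.

Lemma interior_cell T x : T \in cells Th -> (hull T)° x -> Omega x.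
Proof.
move=> cT xT; apply: near_closure_interior.
by apply: filterS xT => y; exact: hull_closure.
Qed.

(** Near a point inside the common edge, the sign of [bary T B] decides whether a point is in [T] or
    in [T']; so the closure is a neighbourhood. *)
Lemma shared_edge_interior T T' M A x : T \in cells Th -> T' \in cells Th ->
  T != T' ->
  M \in T -> A \in T -> M \in T' -> A \in T' -> M != A ->
  hull T x -> hull T' x -> 0 < bary T M x -> 0 < bary T A x -> Omega x.
Proof.
move=> cT cT' TT' MT AT MT' AT' MA xT xT' M0 A0.
have [B [BM BA eT _]] := card3_third (c3 cT) MT AT MA.
have [B' [B'M B'A eT' _]] := card3_third (c3 cT') MT' AT' MA.
have [k0 E] := wedge_opposite tri cT cT' TT' eT eT' MA BM BA B'M B'A.
have M0' : 0 < bary T' M x by rewrite -(bary_common tri M cT cT' xT xT').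
have A0' : 0 < bary T' A x by rewrite -(bary_common tri A cT cT' xT xT').
apply: near_closure_interior.
apply: filterS (filterI (filterI (affine_near_gt0 M0) (affine_near_gt0 A0))
  (filterI (affine_near_gt0 M0') (affine_near_gt0 A0'))) => y [[yM yA] [yM' yA']].
have [yB|yB] := leP 0 (bary T B y).
  apply: (hull_closure cT); apply/(hullP (c3 cT) (ci cT)) => i.
  have [iT|/(bary_out (c3 cT) (ci cT))->//] := boolP (i \in T).
  by move: iT; rewrite [in X in is_true X -> _]eT !inE => /orP[/orP[]|]/eqP-> //;
    exact: ltW.
apply: (hull_closure cT'); apply/(hullP (c3 cT') (ci cT')) => i.
have [iT|/(bary_out (c3 cT') (ci cT'))->//] := boolP (i \in T').
move: iT; rewrite [in X in is_true X -> _]eT' !inE => /orP[/orP[]|]/eqP->;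
  try exact: ltW.
by move: yB; rewrite E nmulr_llt0// => /ltW.
Qed.

(** A cell through [x] contains [M] and [A], hence is [T]. If [x] were in [Omega], nearby points
    would all be in [T] and [x] would be interior to [T]. *)
Lemma free_edge_frontier T M A x : T \in cells Th -> M \in T -> A \in T -> M != A ->
  (forall T', T' \in cells Th -> M \in T' -> A \in T' -> T' = T) ->
  hull T x -> 0 < bary T M x -> 0 < bary T A x ->
  (forall B, B \in T -> B != M -> B != A -> bary T B x = 0) ->
  frontier Omega x.
Proof.
move=> cT MT AT MA free xT M0 A0 Bx; apply/frontierP; split;
  first exact: hull_closure cT xT.
move=> /closure_interior Ox.
have [B [BM BA eT _]] := card3_third (c3 cT) MT AT MA.
have BT : B \in T by rewrite eT !inE eqxx ?orbT.
have only T' : T' \in cells Th -> hull T' x -> T' = T.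
  move=> cT' xT'; apply: free => //; apply/negPn/negP => nT'.
    by move: M0; rewrite (bary_common tri M cT cT' xT xT')
      (bary_out (c3 cT') (ci cT'))// ltxx.
  by move: A0; rewrite (bary_common tri A cT cT' xT xT')
    (bary_out (c3 cT') (ci cT'))// ltxx.
have : \forall y \near x, hull T y.
  apply: filterS (filterI Ox (near_hulls x)) => y [/closure_hull[T' cT' yT'] h].
  by rewrite -(only T' cT' (h T' cT' yT')).
move=> /(interior_hullP (c3 cT) (ci cT))/(_ B BT).
by rewrite Bx// ltxx.
Qed.

(** * Hat functions and their values on the frontier *)

Definition hat M (x : plane R) : R :=
  xget 0 [set r | exists2 T, T \in cells Th & hull T x /\ r = bary T M x].

(** By [bary_common] the value does not depend on the cell chosen. *)
Lemma hatE M T x : T \in cells Th -> hull T x -> hat M x = bary T M x.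
Proof.
move=> cT xT; rewrite /hat;
  case: xgetP => [r -> [T' cT' [xT' ->]]|/(_ (bary T M x))[]].
  exact: (bary_common tri M cT' cT xT' xT).
by exists T.
Qed.

Lemma within_bigU_continuous (I : Type) (s : seq I) (F : I ->
  set (plane R)) (f : plane R -> R) :
  (forall i, closed (F i)) -> (forall i, {within F i, continuous f}) ->
  {within \big[setU/set0]_(i <- s) F i, continuous f}.
Proof.
move=> cF fF; suff [] : closed (\big[setU/set0]_(i <- s) F i) /\
  {within \big[setU/set0]_(i <- s) F i, continuous f} by [].
elim/big_ind: _ => //.
- by split; [exact: closed0|exact: continuous_subspace0].
- by move=> A B [cA fA] [cB fB]; split; [exact: closedU|exact: withinU_continuous].
Qed.

Lemma hat_V1 M : V1 Th Omega (hat M).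
Proof.
split; last first.
  move=> T cT; exists (bary_coef T M).1, (bary_coef T M).2 => x xT.
  by rewrite (hatE _ cT xT).
rewrite -(tri_cover tri) (_ : \bigcup_(_ in _) _
  = \bigcup_(T in [set` enum (cells Th)]) hull T); last first.
  by apply: eq_bigcupl; split=> T /=; rewrite mem_enum.
rewrite bigcup_seq big_seq.
rewrite (eq_bigr (fun T => if T \in cells Th then hull T else set0)); last first.
  by move=> T; rewrite mem_enum => ->.
rewrite -big_seq; apply: within_bigU_continuous => T.
  by case: ifP => [cT|_]; [exact: closed_hull (c3 cT) (ci cT)|exact: closed0].
case: ifP => [cT|_]; last exact: continuous_subspace0.
apply: (@subspace_eq_continuous _ _ _ (bary T M)).
  by move=> x; rewrite inE => xT; exact/esym/(hatE M cT xT).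
by apply: continuous_subspaceT; exact: continuous_affine.
Qed.

Lemma hat_coord M M' : hat M (coord M') = (M' == M)%:R.
Proof.
have [T cT MT'] := tri_vertex tri M'.
rewrite (hatE _ cT (hull_coord cT MT')).
have [MT|MT] := boolP (M \in T);
  first by rewrite (bary_coord (c3 cT) (ci cT))// eq_sym.
rewrite (bary_out (c3 cT) (ci cT))//.
by have [E|] := eqVneq M' M => //; rewrite E (negPf MT) in MT'.
Qed.

Lemma psi_nodal M : nodal Omega M (psi Omega M).
Proof. by apply: (@xgetI _ _ _ (hat M)); split; [exact: hat_V1|exact: hat_coord]. Qed.

(** The inside of the edge is [free_edge_frontier]. The end [M] follows by openness: if it were in
    [Omega], so would be nearby points of the edge. *)
Lemma free_edge_seg_frontier T M A t : T \in cells Th -> M \in T -> A \in T ->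
  M != A ->
  (forall T', T' \in cells Th -> M \in T' -> A \in T' -> T' = T) ->
  0 <= t < 1 -> frontier Omega ((1 - t) *: coord M + t *: coord A).
Proof.
move=> cT MT AT MA free.
have pos s : 0 < s < 1 -> frontier Omega ((1 - s) *: coord M + s *: coord A).
  move=> /andP[s0 s1].
  have bx i : i \in T -> bary T i ((1 - s) *: coord M + s *: coord A)
    = (1 - s) * (i == M)%:R + s * (i == A)%:R.
    move=> iT; rewrite /bary affine_conv -!/(bary T i _).
    by rewrite !(bary_coord (c3 cT) (ci cT) iT).
  apply: (free_edge_frontier cT MT AT MA free).
  - apply/(hullP (c3 cT) (ci cT)) => i.
    have [iT|/(bary_out (c3 cT) (ci cT))->//] := boolP (i \in T).
    by rewrite bx// addr_ge0// mulr_ge0 ?ler0n ?subr_ge0// ltW.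
  - by rewrite bx// eqxx (negPf MA) /=; lra.
  - by rewrite bx// eqxx eq_sym (negPf MA) /=; lra.
  - by move=> B BT BM BA; rewrite bx// (negPf BM) (negPf BA) /=; lra.
move=> /andP[]; rewrite le_eqVlt => /orP[/eqP<- _|t0 t1]; last by apply: pos;
  rewrite t0.
rewrite subr0 scale1r scale0r addr0.
have cM : closure Omega (coord M) := hull_closure cT (hull_coord cT MT).
apply/frontierP; split => // OM.
have /(cvg_segment (coord A)) /nbhs_ballP[e /= e0 he] : nbhs (coord M) Omega.
  by apply: open_nbhs_nbhs; split => //; exact: polygon_open.
pose s := Num.min (e / 2) (1 / 2).
have s01 : 0 < s < 1 by rewrite lt_min gt_min; lra.
have /frontierP[_] := pos s s01; apply; apply: he.
by rewrite /ball /= sub0r normrN gtr0_norm ?(andP s01).1// gt_min; lra.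
Qed.

(** A frontier point with positive value is neither [M] nor interior to a cell, so it is inside an
    edge from [M]. A shared edge would put it in [Omega]; a free edge would put [M] on the
    frontier. *)
Lemma hat_frontier M x : interior_vertex Omega M -> frontier Omega x -> hat M x = 0.
Proof.
move=> /asboolP OM Fx; have /frontierP[cx nOx] := Fx.
have [T cT xT] := closure_hull cx; rewrite (hatE _ cT xT).
have xb := proj1 (hullP (c3 cT) (ci cT) x) xT.
apply/eqP/negPn/negP => bM.
have M0 : 0 < bary T M x by rewrite lt_neqAle eq_sym bM xb.
have MT : M \in T by apply: contraT => MT;
  rewrite (bary_out (c3 cT) (ci cT)) ?ltxx in M0.
have [[A AT [AM A0]]|nA] := pselect (exists2 A, A \in T & A != M /\ 0 < bary T A x);
  last first.
  apply: nOx; rewrite -(bary_comb (c3 cT) (ci cT) x) (bigD1 M)//= big1 ?addr0.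
    suff -> : bary T M x = 1 by rewrite scale1r.
    rewrite -(bary_sum (c3 cT) (ci cT) x) (bigD1 M)//= big1 ?addr0// =>
      i /andP[iT iM].
    by apply/eqP/negPn/negP => bi; apply: nA; exists i => //; split => //;
      rewrite lt_neqAle eq_sym bi xb.
  move=> i /andP[iT iM]; suff -> : bary T i x = 0 by rewrite scale0r.
  by apply/eqP/negPn/negP => bi; apply: nA; exists i => //; split => //;
    rewrite lt_neqAle eq_sym bi xb.
rewrite eq_sym in AM.
have [B [BM BA eT sumT]] := card3_third (c3 cT) MT AT AM.
have [B0|B0] := ltP 0 (bary T B x).
  apply: nOx; apply: (interior_cell cT); apply/(interior_hullP (c3 cT) (ci cT)) => i.
  by rewrite [in X in is_true X -> _]eT !inE => /orP[/orP[]|]/eqP->.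
have {}B0 : bary T B x = 0 by apply/eqP; rewrite eq_le B0 xb.
have [[T' cT' [MT' AT' TT']]|free] :=
  pselect (exists2 T', T' \in cells Th & [/\ M \in T', A \in T' & T != T']).
  apply: nOx; apply: (shared_edge_interior cT cT' TT' MT AT MT' AT' AM xT _ M0 A0).
  apply/(hullP (c3 cT') (ci cT')) => i.
  have [Sl Sx] : \sum_(i in [set M; A]%SET) bary T i x = 1 /\
      x = \sum_(i in [set M; A]%SET) bary T i x *: coord i.
    have := bary_comb (c3 cT) (ci cT) x; have := bary_sum (c3 cT) (ci cT) x.
    rewrite !sumT B0 scale0r !addr0 => S1 S2.
    by rewrite !big_setU1 ?inE//= !big_set1 S1 S2.
  have MAT' : ([set M; A]%SET \subset T')
    by rewrite finset.subUset !finset.sub1set MT'.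
  by rewrite (bary_sub tri cT' MAT' Sl Sx); case: ifP.
have /frontierP[_] : frontier Omega (coord M); last by [].
have := @free_edge_seg_frontier T M A 0 cT MT AT AM.
rewrite subr0 scale1r scale0r addr0 => h; apply: h; last by rewrite lexx ltr01.
move=> T' cT' MT' AT'; apply/eqP/negPn/negP => TT'; apply: free.
by exists T' => //; split => //; rewrite eq_sym.
Qed.

End Boundary.

(** * The star of a vertex is connected *)

Section Star.
Context (R : realType) (Omega : set (plane R)) (Th : mesh R).
Hypotheses (pol : polygon Omega) (tri : is_triangulation Th Omega).
Implicit Types (T S : {set vertex Th}) (A B : vertex Th).

Let c3 T : T \in cells Th -> #|T| = 3 := @cell_card R Omega Th tri T.
Let ci T : T \in cells Th -> affinely_independent T := @cell_ind R Omega Th tri T.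

Variable M : vertex Th.

Lemma closed_cone T : closed (cone M T).
Proof.
rewrite (_ : cone M T = \bigcap_(i in [set i | i != M]) [set x | 0 <= bary T i x]).
  apply: closed_bigI => i _.
  exact: (closed_comp (fun y _ =>
    @continuous_affine R (bary_coef T i) y) (@closed_ge R 0)).
by apply/seteqP; split => x h i; exact: h.
Qed.

(** * Cells around [M] whose edges at [M] are all shared *)

Section Component.
Variable C : {set {set vertex Th}}.
Hypothesis C_star : forall T, T \in C -> T \in cells Th /\ M \in T.
Hypothesis C_paired : forall T A, T \in C -> A \in T -> A != M ->
  exists T', [/\ T' \in C, T' != T & A \in T'].

(** Inside a sector this is clear. On a bounding ray, the second cell on that edge covers the other
    side by [wedge_opposite]. *)
Lemma cones_nbhs T x : T \in C -> cone M T x -> x != coord M ->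
  \forall y \near x, exists2 T', T' \in C & cone M T' y.
Proof.
move=> CT xT xM; have [cT MT] := C_star CT.
have [A AT [AM A0]] : exists2 A, A \in T & A != M /\ 0 < bary T A x.
  apply: contrapT => nA.
  have b0 i : i \in T -> i != M -> bary T i x = 0.
    move=> iT iM; apply/eqP/negPn/negP => bi; apply: nA; exists i => //.
    by split => //; rewrite lt_neqAle eq_sym bi xT.
  move/eqP: xM; apply; rewrite -(bary_comb (c3 cT) (ci cT) x) (bigD1 M)//= big1
    ?addr0.
    have := bary_sum (c3 cT) (ci cT) x; rewrite (bigD1 M)//= big1 ?addr0.
      by move=> ->; rewrite scale1r.
    by move=> i /andP[iT iM]; exact: b0.
  by move=> i /andP[iT iM]; rewrite b0// scale0r.
have MA : M != A by rewrite eq_sym.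
have [B [BM BA eT sumT]] := card3_third (c3 cT) MT AT MA.
have coneT S D y : S \in C -> S = [set M; A; D]%SET -> 0 <= bary S A y ->
  0 <= bary S D y -> cone M S y.
  move=> CS eS yA yD i iM; have [cS _] := C_star CS.
  have [iS|/(bary_out (c3 cS) (ci cS))->//] := boolP (i \in S).
  by move: iS; rewrite [in X in is_true X -> _]eS !inE (negPf iM) /= => /orP[]/eqP->.
have [B0|B0] := ltP 0 (bary T B x).
  apply: filterS (filterI (affine_near_gt0 A0) (affine_near_gt0 B0)) => y [yA yB].
  by exists T => //; apply: coneT eT (ltW yA) (ltW yB).
have {}B0 : bary T B x = 0 by apply/eqP; rewrite eq_le B0 xT.
have [T' [CT' T'T AT']] := C_paired CT AT AM.
have [cT' MT'] := C_star CT'.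
have [B' [B'M B'A eT' _]] := card3_third (c3 cT') MT' AT' MA.
have TT' : T != T' by rewrite eq_sym.
have [k0 E] := wedge_opposite tri cT cT' TT' eT eT' MA BM BA B'M B'A.
have A0' : 0 < bary T' A x.
  rewrite [bary T' A x](affine_bary (c3 cT) (ci cT)) sumT B0 mul0r addr0
    -!/(bary T' A _).
  rewrite (bary_coord (c3 cT') (ci cT') AT' MT')
    (bary_coord (c3 cT') (ci cT') AT' AT').
  by rewrite eqxx (negPf AM) mulr0 add0r mulr1.
apply: filterS (filterI (affine_near_gt0 A0) (affine_near_gt0 A0')) => y [yA yA'].
have [yB|yB] := leP 0 (bary T B y).
  by exists T => //; apply: coneT eT (ltW yA) yB.
exists T' => //; apply: coneT eT' (ltW yA') _ => //.
by move: yB; rewrite E nmulr_llt0// => /ltW.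
Qed.

Lemma cones_segment (u w : plane R) T0 : T0 \in C -> cone M T0 u ->
  (forall t, 0 <= t <= 1 -> (1 - t) *: u + t *: w != coord M) ->
  exists2 T, T \in C & cone M T w.
Proof.
move=> CT0 uT0 avoid.
pose Q : set (plane R) := \bigcup_(T in [set` C]) cone M T.
pose z t := (1 - t) *: u + t *: w.
have cz : continuous z := @continuous_segment R u w.
have cQ : closed Q by apply: closed_bigcup => // T _; exact: closed_cone.
(* Along the segment, the union [Q] of the cones is closed, and open by
   [cones_nbhs]. *)
suff : `[0, 1]%classic `&` z @^-1` Q = `[0, 1]%classic.
  have : `[0, 1]%classic (1 : R) by rewrite /= in_itv/= ler01 lexx.
  move=> + E; rewrite -E => -[_ [T CT]].
  by rewrite /z subrr scale0r add0r scale1r => ?; exists T.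
apply: (@segment_connected R 0 1).
- exists 0; split; first by rewrite /= in_itv/= ler01 lexx.
  by exists T0 => //; rewrite /z subr0 scale1r scale0r addr0.
- exists (z @^-1` Q°).
    by apply: open_comp => [? _|]; [exact: cz|exact: open_interior].
  apply/seteqP; split => t [t01 zt]; split => //; last exact: (interior_subset zt).
  have [T CT zT] := zt; have := cones_nbhs CT zT (avoid t _).
  move=> /(_ _) h; have {h} : nbhs (z t) [set y | exists2 T', T' \in C & cone M T' y].
    by apply: h; move: t01; rewrite /= in_itv.
  by apply: filterS => y [S CS yS]; exists S.
- exists (z @^-1` Q) => //.
  by apply: closed_comp => // ? _; exact: cz.
Qed.

(** A point strictly inside the sector of [T1], joined to [A0] by a segment avoiding [M], lies in
    the cone of a cell of [C]; [cone_common] identifies that cell with [T1]. *)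
Lemma paired_component_full T0 T1 : T0 \in C -> T1 \in cells Th -> M \in T1 ->
  T1 \in C.
Proof.
move=> CT0 cT1 MT1; have [cT0 MT0] := C_star CT0.
have [A0 A0T A0M] := card3_other M (c3 cT0).
have [A AT AM] := card3_other M (c3 cT1).
have MA : M != A by rewrite eq_sym.
have [B [BM BA eT1 sumT1]] := card3_third (c3 cT1) MT1 AT MA.
have BT : B \in T1 by rewrite eT1 !inE eqxx ?orbT.
have reach w : 0 < bary T1 A w -> 0 < bary T1 B w ->
    (forall t, 0 <= t <= 1 -> (1 - t) *: coord A0 + t *: w != coord M) -> T1 \in C.
  move=> wA wB avoid.
  have wT1 i : i \in T1 -> i != M -> 0 < bary T1 i w.
    by rewrite [in X in is_true X -> _]eT1 !inE => /orP[/orP[]|]/eqP->; rewrite ?eqxx.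
  have cw : cone M T1 w.
    move=> i iM; have [iT|/(bary_out (c3 cT1) (ci cT1))->//] := boolP (i \in T1).
    by rewrite ltW// wT1.
  have uT0 : cone M T0 (coord A0).
    move=> i iM; have [iT|/(bary_out (c3 cT0) (ci cT0))->//] := boolP (i \in T0).
    by rewrite (bary_coord (c3 cT0) (ci cT0)).
  have [T CT wT] := cones_segment CT0 uT0 avoid.
  have [cT MT] := C_star CT.
  suff -> : T1 = T by [].
  apply: (cell_subset tri) => //; apply/fintype.subsetP => i iT1.
  have [->//|iM] := eqVneq i M.
  apply/negPn/negP => iT; have := wT1 i iT1 iM.
  by rewrite (cone_common tri cT1 cT MT1 MT cw wT iM) (bary_out (c3 cT) (ci cT))
    ?ltxx.
(* [w1 - M] and [w2 - M] are not parallel, so [M] cannot be on both segments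
   from [A0] to [w1] and [w2]. *)
pose w1 := 3^-1 *: coord M + 3^-1 *: coord A + 3^-1 *: coord B.
pose w2 := 4^-1 *: coord M + 4^-1 *: coord A + 2^-1 *: coord B.
have bw a b c i : a + b + c = 1 -> i \in T1 ->
    bary T1 i (a *: coord M + b *: coord A + c *: coord B) =
    a * (i == M)%:R + b * (i == A)%:R + c * (i == B)%:R.
  move=> abc iT1; rewrite -!(bary_coord (c3 cT1) (ci cT1) iT1)//.
  have -> : c = 1 - a - b by lra.
  by rewrite /bary /affine /dot /= !planeE; ring.
have AB : A != B by rewrite eq_sym.
have w1A : bary T1 A w1 = 3^-1.
  by rewrite bw//; [rewrite (negPf AM) (negPf AB) eqxx /=; ring|lra].
have w1B : bary T1 B w1 = 3^-1.
  by rewrite bw//; [rewrite (negPf BM) (negPf BA) eqxx /=; ring|lra].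
have w2A : bary T1 A w2 = 4^-1.
  by rewrite bw//; [rewrite (negPf AM) (negPf AB) eqxx /=; ring|lra].
have w2B : bary T1 B w2 = 2^-1.
  by rewrite bw//; [rewrite (negPf BM) (negPf BA) eqxx /=; ring|lra].
have hit w : (forall t, 0 <= t <= 1 -> (1 - t) *: coord A0 + t *: w != coord M) \/
    exists t, t != 0 /\ forall i, i \in T1 -> i != M ->
      (1 - t) * bary T1 i (coord A0) + t * bary T1 i w = 0.
  have [[t tM]|h] := pselect (exists t, (1 - t) *: coord A0 + t *: w = coord M);
    last first.
    by left => t _; apply/eqP => tM; apply: h; exists t.
  right; exists t; split.
    apply/eqP => t0; move: tM; rewrite t0 subr0 scale1r scale0r addr0.
    by move/(tri_coord_inj tri)/eqP; rewrite (negPf A0M).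
  move=> i iT1 iM; rewrite -affine_conv tM -/(bary T1 i _).
  by rewrite (bary_coord (c3 cT1) (ci cT1) iT1 MT1) (negPf iM).
have [h1|[t1 [t10 h1]]] := hit w1; first by apply: (reach w1);
  rewrite ?w1A ?w1B// invr_gt0.
have [h2|[t2 [t20 h2]]] := hit w2; first by apply: (reach w2);
  rewrite ?w2A ?w2B// invr_gt0.
have := h1 A AT AM; have := h1 B BT BM; have := h2 A AT AM; have := h2 B BT BM.
rewrite w1A w1B w2A w2B.
set a := bary T1 A _; set b := bary T1 B _ => e1 e2 e3 e4.
(* The equal coordinates of [w1] at [A] and [B] force [a = b]; the unequal ones of [w2] then force
   [t2 = 0]. *)
have ab : (1 - t1) * (a - b) = 0 by lra.
have t11 : 1 - t1 != 0 by apply/eqP => h; move: e4; rewrite h mul0r add0r;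
  move/eqP: t10; lra.
have {ab} ab : a = b by move/eqP: ab; rewrite mulf_eq0 (negPf t11) subr_eq0 => /eqP.
by exfalso; move/eqP: t20; apply; move: e1 e2; rewrite ab; lra.
Qed.

End Component.

(** * Free edges at [M] and the sides of the polygonal line *)

Definition free_edge A := A != M /\
  exists2 T, [/\ T \in cells Th, M \in T & A \in T] &
    forall T', T' \in cells Th -> M \in T' -> A \in T' -> T' = T.

Lemma closed_seg (p q : plane R) : closed (seg p q).
Proof.
have -> : seg p q = (fun t : R => (1 - t) *: p + t *: q) @` `[0, 1]%classic.
  by apply/seteqP; split=> x [t t01 <-]; exists t => //; move: t01; rewrite /= in_itv.
apply: compact_closed; first exact: norm_hausdorff.
apply: continuous_compact; last exact: segment_compact.
exact/continuous_subspaceT/continuous_segment.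
Qed.

(** The point [A'] is in both cones and its coordinate at [A] is positive; in [T'], of which [A'] is
    a vertex, this means [A = A']. *)
Lemma coord_ray A A' T T' (c : R) : T \in cells Th -> T' \in cells Th ->
  M \in T -> M \in T' -> A \in T -> A' \in T' -> A != M -> A' != M -> 0 < c ->
  coord A' - coord M = c *: (coord A - coord M) -> A = A'.
Proof.
move=> cT cT' MT MT' AT AT' AM A'M c0 E.
have [T3 Ti] := (c3 cT, ci cT); have [T'3 T'i] := (c3 cT', ci cT').
have bA' i : i \in T -> i != M -> bary T i (coord A') = c * (i == A)%:R.
  move=> iT iM.
  have -> : coord A' = (1 - c) *: coord M + c *: coord A.
    rewrite -[coord A'](subrK (coord M)) E.
    by apply: plane_eq; rewrite /= !planeE; ring.
  rewrite /bary affine_conv -!/(bary T i _) (bary_coord T3 Ti iT MT)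
    (bary_coord T3 Ti iT AT).
  by rewrite (negPf iM) mulr0 add0r.
have x1 : cone M T (coord A').
  move=> i iM; have [iT|/(bary_out T3 Ti)->//] := boolP (i \in T).
  by rewrite bA'// mulr_ge0 ?ler0n// ltW.
have x2 : cone M T' (coord A').
  move=> i iM; have [iT|/(bary_out T'3 T'i)->//] := boolP (i \in T').
  by rewrite (bary_coord T'3 T'i).
have := cone_common tri cT cT' MT MT' x1 x2 AM; rewrite bA'// eqxx mulr1.
have [AT'1|/(bary_out T'3 T'i)->] := boolP (A \in T'); last by move=> c1;
  rewrite c1 ltxx in c0.
by rewrite (bary_coord T'3 T'i)//; have [//|_ c1] := eqVneq A A';
  rewrite c1 ltxx in c0.
Qed.

(** A short initial piece of a free edge lies in the frontier, hence along a side through [M];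
    [ray_uniq] leaves one free edge for each of the two directions. *)
Lemma free_edges_le2 (F : {set vertex Th}) :
  (forall A, A \in F -> free_edge A) -> (#|F| <= 2)%N.
Proof.
move=> freeF.
have [_ _ _ _ [n [p [[n3 p_inj p_simple] pO]]]] := pol.
(* The edge from [M] to [A] runs along side [i], forwards if [up] and backwards otherwise. The
   strict bound on [a] says that the side continues beyond [M] in that direction. *)
pose ray (i : 'I_n) (up : bool) A := exists a c,
  [/\ 0 <= a <= 1, if up then a < 1 /\ 0 < c else 0 < a /\ c < 0,
   coord M = (1 - a) *: p i + a *: p (ordS i) &
   coord A - coord M = c *: (p (ordS i) - p i)].
have rayF A : A \in F -> exists i up, ray i up A.
  move=> /freeF[AM [T [cT MT AT] free]].
  have MA : M != A by rewrite eq_sym.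
  have front t := free_edge_seg_frontier pol tri cT MT AT MA free (t := t).
  have near_M : \forall y \near coord M, forall i, seg (p i) (p (ordS i)) y ->
    seg (p i) (p (ordS i)) (coord M).
    apply: (@filter_forall _ _ (fun i y => seg (p i) (p (ordS i)) y ->
      seg (p i) (p (ordS i)) (coord M)) (nbhs (coord M))) => i.
    have [h|h] := pselect (seg (p i) (p (ordS i)) (coord M)); first by apply: nearW.
    have : nbhs (coord M) (~` seg (p i) (p (ordS i))).
      by apply: open_nbhs_nbhs; split => //; exact/closed_openC/closed_seg.
    by apply: filterS => y.
  have /(cvg_segment (coord A)) /nbhs_ballP[e /= e0 he] := near_M.
  pose t := Num.min (e / 2) (1 / 2).
  have [t0 t1] : 0 < t /\ t < 1 by rewrite /t lt_min gt_min; split; lra.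
  have := front t (ltac:(by rewrite ltW)); rewrite pO => -[i _ yi].
  have Mi : seg (p i) (p (ordS i)) (coord M).
    apply: (he t _ i yi).
    by rewrite /ball /= sub0r normrN gtr0_norm// gt_min; lra.
  (* [M] and the nearby point of the edge have parameters [a] and [b] on side [i]; the sign of
     [b - a] is the direction. *)
  case: Mi yi => a /andP[a0 a1] Ma [b /andP[b0 b1] yb].
  have tA : t *: (coord A - coord M) = (b - a) *: (p (ordS i) - p i).
    have -> : t *: (coord A - coord M) = (1 - t) *: coord M + t *: coord A - coord M.
      by apply: plane_eq; rewrite /= !planeE; ring.
    by rewrite -yb -Ma; apply: plane_eq; rewrite /= !planeE; ring.
  have cA : coord A - coord M = ((b - a) / t) *: (p (ordS i) - p i).
    by rewrite mulrC -scalerA -tA scalerA mulVf ?scale1r// gt_eqF.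
  have ab : b - a != 0.
    apply/eqP => ab; move/eqP: AM; apply; apply: (tri_coord_inj tri).
    by apply/eqP; rewrite -subr_eq0 cA ab mul0r scale0r.
  exists i, (0 < b - a), a, ((b - a) / t); split => //; first by rewrite a0 a1.
  case: ifP => [ba|/negbT]; first by split; [lra|rewrite divr_gt0].
  rewrite -leNgt le_eqVlt (negPf ab) /= => ba.
  by split; [lra|rewrite pmulr_llt0// invr_gt0].
(* A corner and its successor coincide only when [n = 1]. *)
have segp i : p i != p (ordS i).
  apply/eqP => /p_inj/(congr1 val) /=.
  have := ltn_ord i; rewrite leq_eqVlt => /orP[/eqP E|h].
    by rewrite E modnn => i0; move: E; rewrite i0 => n1; rewrite -n1 in n3.
  by rewrite modn_small// => /eqP; rewrite -[X in X == _]addn0 -addn1 eqn_add2l.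
(* If [M] is on two sides it is a corner, which starts only one side and ends only
   one; on a single side, [up] determines the direction. *)
have ray_uniq i j up A A' : A \in F -> A' \in F -> ray i up A -> ray j up A' ->
  A = A'.
  move=> AF A'F [a [c [a01 cup Ma cA]]] [a' [c' [a'01 c'up Ma' cA']]].
  have [AM [T [cT MT AT] _]] := freeF A AF.
  have [A'M [T' [cT' MT' AT'] _]] := freeF A' A'F.
  have ij : i = j.
    apply/eqP/negPn/negP => ij.
    have Mi : seg (p i) (p (ordS i)) (coord M) by exists a.
    have Mj : seg (p j) (p (ordS j)) (coord M) by exists a'.
    have [Mi' Mj'] := p_simple i j ij (coord M) (conj Mi Mj).
    have corner k b : 0 <= b <= 1 -> coord M = (1 - b) *: p k + b *: p (ordS k) ->
        [set p k; p (ordS k)] (coord M) ->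
        (if up then b < 1 else 0 < b) -> coord M = p (if up then k else ordS k).
      move=> b01 Mb [Mk|Mk] bup.
        have b0 : b = 0.
          have : b *: (p (ordS k) - p k) = 0.
            by rewrite -(subrr (coord M)) {1}Mb Mk; apply: plane_eq;
              rewrite /= !planeE; ring.
          move/eqP; rewrite scaler_eq0 subr_eq0 eq_sym.
          by rewrite [p (ordS k) == _]eq_sym (negPf (segp k)) orbF => /eqP.
        by move: bup; rewrite b0 ltxx; case: up cup c'up.
      have b1 : b = 1.
        have : (1 - b) *: (p (ordS k) - p k) = 0.
          by rewrite -(subrr (coord M)) {2}Mb Mk; apply: plane_eq;
            rewrite /= !planeE; ring.
        move/eqP; rewrite scaler_eq0 !subr_eq0 [p (ordS k) == _]eq_sym
          (negPf (segp k)) orbF.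
        by move=> /eqP.
      by move: bup; rewrite b1 ltxx; case: up cup c'up.
    have Ei : coord M = p (if up then i else ordS i).
      by apply: (corner i a) => //; case: up cup {c'up corner} => -[].
    have Ej : coord M = p (if up then j else ordS j).
      by apply: (corner j a') => //; case: up c'up {cup corner Ei} => -[].
    move: Ei; rewrite Ej => /p_inj; move/eqP: ij;
      case: up {cup c'up corner Ej} => + h; apply => //.
    exact/esym/(can_inj (@ordSK _)).
  subst j.
  apply: (coord_ray (c := c' / c) cT cT' MT MT' AT AT' AM A'M).
    by case: up cup c'up => -[_ c0] [_ c'0];
      [rewrite divr_gt0|rewrite nmulr_rgt0// invr_lt0].
  have c0 : c != 0 by case: up cup {c'up} => -[_ c0]; [rewrite gt_eqF|rewrite lt_eqF].
  by rewrite cA' cA scalerA mulfVK.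
pose f A : bool := `[< exists i, ray i true A >].
have f_inj : {in F &, injective f}.
  move=> A A' AF A'F; rewrite /f.
  case: asboolP => [[i rA]|nA] /esym.
    by move=> /asboolP[j rA']; exact: ray_uniq rA rA'.
  move=> /asboolP nA'.
  have [i [[] rA]] := rayF A AF; first by case: nA; exists i.
  have [j [[] rA']] := rayF A' A'F; first by case: nA'; exists j.
  exact: ray_uniq rA rA'.
by rewrite -card_bool -(card_in_imset f_inj) max_card.
Qed.

(** * Parity of the number of unshared edges at [M], and connectedness *)

Definition edge_degree (C : {set {set vertex Th}}) A := #|[set T in C | A \in T]%SET|.

(** Degrees are at most 2, so their sum, which is even, has the parity of the number of degrees
    equal to 1. *)
Lemma odd_edge_degree (C : {set {set vertex Th}}) :
  (forall T, T \in C -> T \in cells Th /\ M \in T) ->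
  ~~ odd #|[set A | (A != M) && (edge_degree C A == 1%N)]%SET|.
Proof.
move=> C_star.
have deg_le2 A : A != M -> (edge_degree C A <= 2)%N.
  move=> AM; rewrite leqNgt; apply/negP => /card_gt2P[T [T' [T'' [[]]]]].
  rewrite !inE => /andP[CT AT] /andP[CT' AT'] /andP[CT'' AT'']
    [/eqP n1 /eqP n2 /eqP n3].
  have [[cT MT] [cT' MT'] [cT'' MT'']] :=
    And3 (C_star _ CT) (C_star _ CT') (C_star _ CT'').
  have MA : M != A by rewrite eq_sym.
  by case: (edge_cells_le2 tri cT cT' cT'' MA MT AT MT' AT' MT'' AT'') => // /esym.
(* Each cell of [C] has two edges at [M]. *)
have sum_deg : (\sum_(A | A != M) edge_degree C A = #|C| * 2)%N.
  transitivity (\sum_(A | A != M) \sum_(T in C) (A \in T))%N.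
    apply: eq_bigr => A _; rewrite /edge_degree -sum1_card big_mkcond [RHS]big_mkcond
      /=.
    by apply: eq_bigr => T _; rewrite inE; case: (T \in C); case: (A \in T).
  rewrite exchange_big /= -sum_nat_const; apply: eq_bigr => T CT.
  have [cT MT] := C_star T CT.
  have : #|T :\ M| = 2%N by have := cardsD1 M T; rewrite MT c3// => -[].
  move=> <-; rewrite -sum1_card big_mkcond [RHS]big_mkcond /=.
  by apply: eq_bigr => A _; rewrite !inE; case: (A != M); case: (A \in T).
have : odd (\sum_(A | A != M) edge_degree C A)
  = odd #|[set A | (A != M) && (edge_degree C A == 1%N)]%SET|.
  rewrite -sum1_card.
  have -> : (\sum_(A in [set A | (A != M) && (edge_degree C A == 1%N)]%SET) 1 =
             \sum_(A | A != M) (edge_degree C A == 1%N))%N.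
    rewrite big_mkcond [RHS]big_mkcond /=; apply: eq_bigr => A _.
    by rewrite inE; case: (A != M); case: (_ == 1%N).
  apply: (big_ind2 (fun a b => odd a = odd b)) => //.
    by move=> a1 a2 b1 b2 h1 h2; rewrite !oddD h1 h2.
  by move=> A /deg_le2; case: (edge_degree C A) => [|[|[|[]]]].
by rewrite sum_deg oddM andbF => <-.
Qed.

(** Without edges of degree 1, [paired_component_full] would put [T1] in [C]; parity excludes
    exactly one such edge. *)
Lemma free_component (C : {set {set vertex Th}}) T0 T1 :
  (forall T, T \in C -> T \in cells Th /\ M \in T) ->
  T0 \in C -> T1 \in cells Th -> M \in T1 -> T1 \notin C ->
  (1 < #|[set A | (A != M) && (edge_degree C A == 1%N)]%SET|)%N.
Proof.
move=> C_star CT0 cT1 MT1 CT1.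
have := odd_edge_degree C_star.
suff : (0 < #|[set A | (A != M) && (edge_degree C A == 1%N)]%SET|)%N by case: #|_| =>
  [//|[|]].
rewrite lt0n; apply/eqP => /card0_eq free0; move/negP: CT1; apply.
apply: (paired_component_full C_star _ CT0 cT1 MT1) => T A CT AT AM.
have := free0 A; rewrite !inE AM /= => /negbT deg1.
apply: contrapT => noT'; move/eqP: deg1; apply; apply/eqP/cards1P; exists T.
apply/setP => T'; rewrite !inE; apply/andP/eqP => [[CT' AT']|-> //].
by apply/eqP/negPn/negP => T'T; apply: noT'; exists T'.
Qed.

(** Otherwise [C] and the rest [D] of the star each have two edges of degree 1. As [C] is closed
    under passing across edges at [M], these four edges are distinct and free in the whole mesh,
    against [free_edges_le2]. *)
Lemma star_connected (C : {set {set vertex Th}}) T0 T1 :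
  (forall T, T \in C -> T \in cells Th /\ M \in T) ->
  (forall T T' A, T \in C -> T' \in cells Th -> M \in T' -> A != M ->
     A \in T -> A \in T' -> T' \in C) ->
  T0 \in C -> T1 \in cells Th -> M \in T1 -> T1 \in C.
Proof.
move=> C_star C_closed CT0 cT1 MT1; apply/negPn/negP => CT1.
pose D := [set T in cells Th | (M \in T) && (T \notin C)]%SET.
have D_star T : T \in D -> T \in cells Th /\ M \in T by rewrite inE => /and3P[].
have DT1 : T1 \in D by rewrite inE cT1 MT1.
have [cT0 MT0] := C_star T0 CT0.
have DT0 : T0 \notin D by rewrite inE CT0 !andbF.
have fC := free_component C_star CT0 cT1 MT1 CT1.
have fD := free_component D_star DT1 cT0 MT0 DT0.
set FC := [set A | _]%SET in fC; set FD := [set A | _]%SET in fD.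
have FCT A : A \in FC -> A != M /\ exists T,
  [set T' in C | A \in T']%SET = [set T]%SET.
  by rewrite inE => /andP[AM /cards1P].
have FDT A : A \in FD -> A != M /\ exists T,
  [set T' in D | A \in T']%SET = [set T]%SET.
  by rewrite inE => /andP[AM /cards1P].
have free A : A \in FC :|: FD -> free_edge A.
  rewrite finset.in_setU => /orP[/FCT|/FDT] [AM [T defT]]; split => //;
      have := set11 T; rewrite -defT inE => /andP[CT AT].
    have [cT MT] := C_star T CT; exists T => // T' cT' MT' AT'.
    apply/eqP; have := finset.in_set1 T' T; rewrite -defT inE => <-.
    by rewrite AT' andbT (C_closed T T' A).
  have [cT MT] := D_star T CT; exists T => // T' cT' MT' AT'.
  apply/eqP; have := finset.in_set1 T' T; rewrite -defT inE => <-.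
  rewrite AT' andbT inE cT' MT' /=; apply/negP => CT'.
  by move: CT; rewrite inE => /and3P[_ _ /negP]; apply; exact: (C_closed T' T A).
have := free_edges_le2 free.
suff disj : FC :&: FD = finset.set0.
  rewrite cardsU disj cards0 subn0 leqNgt => /negP; apply.
  by apply: leq_trans (leq_add fC fD).
apply/eqP/negPn/negP => /set0Pn[A];
  rewrite finset.in_setI => /andP[/FCT[AM [T defT]] /FDT[_ [T' defT']]].
have := set11 T; rewrite -defT inE => /andP[CT AT].
have := set11 T'; rewrite -defT' inE => /andP[];
  rewrite inE => /and3P[cT' MT' /negP CT'] AT'.
by apply: CT'; exact: (C_closed T T' A).
Qed.

End Star.

(** * Coefficients of a Raviart-Thomas field *)

Lemma dot_suml (R : realType) (I : finType) (P : pred I) (F : I -> plane R) g :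
  dot (\sum_(i | P i) F i) g = \sum_(i | P i) dot (F i) g.
Proof. by rewrite /dot !planeE !mulr_suml -big_split. Qed.

Lemma derive_near_affine (R : realType) (f : plane R ->
  R) (p : plane R * R) (a v : plane R) :
  (\forall x \near a, f x = affine p x) -> 'D_v f a = dot p.1 v.
Proof.
move=> fp; rewrite (near_eq_derive _ fp) /derive; apply: lim_near_cst;
  first exact: norm_hausdorff.
near=> h.
have h0 : h != 0 by near: h; exact: nbhs_dnbhs_neq.
rewrite /= /affine /dot /= !planeE.
by field.
Unshelve. all: by end_near. Qed.

Section Pairing.
Context (R : realType) (Omega : set (plane R)) (Th : mesh R).
Hypotheses (pol : polygon Omega) (tri : is_triangulation Th Omega).
Local Notation mu2 := (@lebesgue2 R).
Implicit Types (T S : {set vertex Th}) (M A B : vertex Th).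
Implicit Types (tau : plane R -> plane R) (v : plane R -> R).

Let c3 T : T \in cells Th -> #|T| = 3 := @cell_card R Omega Th tri T.
Let ci T : T \in cells Th -> affinely_independent T := @cell_ind R Omega Th tri T.

Definition cell_pairing T tau v : R :=
  \int[mu2]_(x in (hull T)°) dot (tau x) (grad v x)
  + \int[mu2]_(x in (hull T)°) (div tau x * v x).

(** On the open cell the gradient is [p.1] and the divergence [2 * beta], so both integrands are
    affine. *)
Lemma cell_pairing_affine T tau v alpha beta p : T \in cells Th ->
  (forall x, (hull T)° x -> tau x = alpha + beta *: x) ->
  (forall x, hull T x -> v x = affine p x) ->
  cell_pairing T tau v =
  area T * (dot alpha p.1 + beta * dot p.1 (\sum_(i in T) coord i) + 2 * beta * p.2).
Proof.
move=> cT tauT vT; rewrite /cell_pairing.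
have near_in x : (hull T)° x -> \forall y \near x, (hull T)° y.
  by move=> xT; apply: open_nbhs_nbhs; split => //; exact: open_interior.
have gradE x : (hull T)° x -> grad v x = p.1.
  move=> xT; have vp : \forall y \near x, v y = affine p y.
    by apply: filterS (near_in x xT) => y /interior_subset; exact: vT.
  rewrite /grad !(derive_near_affine _ vp) /dot /= !mulr1 !mulr0 addr0 add0r.
  by case: (p.1).
have divE x : (hull T)° x -> div tau x = 2 * beta.
  move=> xT; rewrite /div.
  rewrite (@derive_near_affine _ _ (((beta, 0) : plane R), alpha.1)); last first.
    apply: filterS (near_in x xT) => y /tauT ->.
    by rewrite /affine /dot /= !planeE; ring.
  rewrite (@derive_near_affine _ _ (((0, beta) : plane R), alpha.2)); last first.
    apply: filterS (near_in x xT) => y /tauT ->.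
    by rewrite /affine /dot /= !planeE; ring.
  by rewrite /dot /=; ring.
rewrite [X in X + _](@eq_Rintegral _ _ _ mu2 _ (affine (beta *: p.1,
  dot alpha p.1))); last first.
  move=> x; rewrite inE => xT; rewrite tauT// gradE// /affine /dot /= !planeE.
  by ring.
rewrite [X in _ + X](@eq_Rintegral _ _ _ mu2 _ (affine ((2 * beta) *: p.1,
  2 * beta * p.2))); last first.
  move=> x; rewrite inE => xT; rewrite divE// vT; last exact: interior_subset.
  by rewrite /affine /dot /= !planeE; ring.
rewrite !(Rintegral_interior_hull (c3 cT) (ci cT)).
have [q [r [s [_ _ _ _ sumT]]]] := card3_split (c3 cT).
rewrite !sumT /affine /dot /= !planeE /=.
by field.
Qed.

Definition basis_field T M : plane R -> plane R := ext0 T (bT T M).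

Definition field_of (c : {set vertex Th} -> vertex Th -> R) : plane R -> plane R :=
  \sum_(T in cells Th) \sum_(M in T) c T M *: basis_field T M.

Lemma field_of_in c T x : T \in cells Th -> (hull T)° x ->
  field_of c x = \sum_(M in T) c T M *: bT T M x.
Proof.
move=> cT xT; rewrite /field_of fct_sumE (bigD1 T)//= [X in _ + X]big1 ?addr0.
  rewrite fct_sumE; apply: eq_bigr => M MT.
  by rewrite /basis_field /ext0 !fctE /patch mem_set.
move=> T' /andP[cT' T'T]; rewrite fct_sumE big1// => M MT'.
rewrite !fctE /basis_field /ext0 /patch; case: ifPn => [|_]; last by rewrite scaler0.
rewrite inE => /interior_subset xT'.
by move: T'T; rewrite (interior_hull_eq tri cT cT' xT xT') eqxx.
Qed.

Lemma field_of_out c x : (forall T, T \in cells Th -> ~ (hull T)° x) ->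
  field_of c x = 0.
Proof.
move=> xO; rewrite /field_of fct_sumE big1// => T cT.
rewrite fct_sumE big1// => M MT.
rewrite !fctE /basis_field /ext0 /patch; case: ifPn => [|_]; last by rewrite scaler0.
by rewrite inE => /(xO T cT).
Qed.

Lemma cell_pairing_field_of c T v : T \in cells Th -> V1 Th Omega v ->
  cell_pairing T (field_of c) v = \sum_(M in T) c T M * v (coord M).
Proof.
move=> cT [_ /(_ T cT)[g [k gk]]].
pose h := (2 * area T)^-1.
have S0 : area T != 0 by rewrite gt_eqF// (area_gt0 (c3 cT) (ci cT)).
pose s := \sum_(i in T) coord i.
(* With [s] the sum of the vertices, [bT T M x] is [h *: (x + 2 *: coord M - s)]. *)
pose alpha := \sum_(M in T) (c T M * h) *: (2 *: coord M - s).
pose beta := \sum_(M in T) c T M * h.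
rewrite (@cell_pairing_affine _ _ _ alpha beta (g, k) cT _ gk) -/s; last first.
  move=> x xT; rewrite (field_of_in _ cT xT) /alpha /beta scaler_suml -big_split /=.
  apply: eq_bigr => M MT.
  have -> : s = coord M + \sum_(j in T :\ M) coord j by rewrite /s (big_setD1 M).
  by rewrite /bT; apply: plane_eq; rewrite /= !planeE -/h; ring.
have -> : dot alpha g = \sum_(M in T) (c T M * h) * (2 * dot (coord M) g - dot s g).
  rewrite /alpha dot_suml; apply: eq_bigr => M _.
  by rewrite /dot /= !(fst_scale, snd_scale, scaleRE); ring.
rewrite /beta mulr_sumr !mulr_suml -!big_split mulr_sumr /=.
apply: eq_bigr => M MT; rewrite gk; last exact: hull_coord tri _ _ cT MT.
by rewrite /h /dot; field.
Qed.

Lemma pairing_field_of c v : V1 Th Omega v ->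
  pairing Th (field_of c) v =
  \sum_M v (coord M) * \sum_(T in cells Th | M \in T) c T M.
Proof.
move=> v1; transitivity (\sum_(T in cells Th) \sum_(M in T) c T M * v (coord M)).
  by apply: eq_bigr => T cT; exact: cell_pairing_field_of.
rewrite (exchange_big_dep predT)//=; apply: eq_bigr => M _.
by rewrite mulr_sumr; apply: eq_bigr => T _; rewrite mulrC.
Qed.

(** Pairing with [hat M] on the single cell [T] reads off [c T M]. *)
Lemma field_of_inj c : field_of c = 0 ->
  forall T M, T \in cells Th -> M \in T -> c T M = 0.
Proof.
move=> c0 T M cT MT.
have vM := hat_V1 tri M.
have [g [k gk]] := vM.2 T cT.
have := cell_pairing_field_of c cT vM.
rewrite (bigD1 M)//= (hat_coord tri) eqxx mulr1 big1 ?addr0; last first.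
  by move=> i /andP[_ /negPf iM]; rewrite (hat_coord tri) iM mulr0.
rewrite (@cell_pairing_affine _ _ _ 0 0 (g, k) cT _ gk); last first.
  by move=> x _; rewrite c0 scale0r addr0.
by move=> <-; rewrite /dot /=; ring.
Qed.

Lemma field_of_RT c : RT Th (field_of c).
Proof.
split; last by move=> x; exact: field_of_out.
move=> T cT; pose h := (2 * area T)^-1.
exists (\sum_(M in T) (c T M * h) *: (coord M - \sum_(j in T :\ M) coord j)),
  (\sum_(M in T) c T M * h).
move=> x xT; rewrite (field_of_in _ cT xT) scaler_suml -big_split /=.
apply: eq_bigr => M MT.
by rewrite /bT; apply: plane_eq; rewrite /= !planeE -/h; ring.
Qed.

Lemma RT_field_of tau : RT Th tau -> exists c, tau = field_of c.
Proof.
move=> [tauT tau0].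
have /choice[ab abP] : forall T, exists ab : plane R * R, T \in cells Th ->
    forall x, (hull T)° x -> tau x = ab.1 + ab.2 *: x.
  move=> T; have [cT|cT] := boolP (T \in cells Th); last by exists 0.
  by have [a [b h]] := tauT T cT; exists (a, b).
(* The coefficients must have sum [C T] and first moment [w T]. Coordinates of [w T] have sum 1 and
   that moment; [C T - 1] times those of the origin corrects the sum and leaves the moment
   unchanged. *)
pose C T := 2 * area T * (ab T).2.
pose w T := 2^-1 *: ((2 * area T) *: (ab T).1 + C T *: \sum_(i in T) coord i).
exists (fun T i => bary T i (w T) + (C T - 1) * bary T i 0).
apply/funext => x.
have [[T cT xT]|xO] := pselect (exists2 T, T \in cells Th & (hull T)° x); last first.
  by rewrite field_of_out ?tau0// => T cT xT; apply: xO; exists T.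
rewrite (abP T cT x xT) (field_of_in _ cT xT).
have S0 : area T != 0 by rewrite gt_eqF// (area_gt0 (c3 cT) (ci cT)).
have := bary_comb (c3 cT) (ci cT) (w T); have := bary_comb (c3 cT) (ci cT) 0.
have := bary_sum (c3 cT) (ci cT) (w T); have := bary_sum (c3 cT) (ci cT) 0.
set b0 := bary T ^~ 0; set bw := bary T ^~ (w T) => s0 sw c0 cw.
pose s := \sum_(i in T) coord i.
have -> : \sum_(M in T) (bw M + (C T - 1) * b0 M) *: bT T M x =
    (2 * area T)^-1 *: (\sum_(M in T) (bw M + (C T - 1) * b0 M) *: (x - s)
      + 2 *: (\sum_(M in T) bw M *: coord M
        + (C T - 1) *: \sum_(M in T) b0 M *: coord M)).
  rewrite !scaler_sumr -!big_split /= !scaler_sumr -!big_split !scaler_sumr;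
    apply: eq_bigr => M MT.
  have -> : s = coord M + \sum_(j in T :\ M) coord j by rewrite /s (big_setD1 M).
  by rewrite /bT; apply: plane_eq; rewrite /= !planeE; ring.
rewrite cw c0 -scaler_suml big_split /= sw -mulr_sumr s0 scaler0 addr0.
by rewrite /w -/s /C; apply: plane_eq; rewrite /= !planeE; field.
Qed.

End Pairing.

(** * Bases *)

Section Span.
Context (R : realType) (V : lmodType R).

Definition lin_span (I : finType) (f : I -> V) : set V :=
  [set \sum_i c i *: f i | c in [set: I -> R]].

Lemma lin_span0 (I : finType) (f : I -> V) : lin_span f 0.
Proof. by exists (fun=> 0) => //; rewrite big1// => i _; rewrite scale0r. Qed.

Lemma lin_spanD (I : finType) (f : I -> V) x y :
  lin_span f x -> lin_span f y -> lin_span f (x + y).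
Proof.
move=> [c _ <-] [d _ <-]; exists (c \+ d) => //.
by rewrite -big_split; apply: eq_bigr => i _; rewrite scalerDl.
Qed.

Lemma lin_spanZ (I : finType) (f : I -> V) a x : lin_span f x -> lin_span f (a *: x).
Proof.
move=> [c _ <-]; exists (fun i => a * c i) => //.
by rewrite scaler_sumr; apply: eq_bigr => i _; rewrite scalerA.
Qed.

Lemma lin_span_sum (I : finType) (f : I ->
  V) (J : Type) (r : seq J) (P : pred J) (F : J -> V) :
  (forall j, P j -> lin_span f (F j)) -> lin_span f (\sum_(j <- r | P j) F j).
Proof. by move=> h; apply: (big_ind (lin_span f)) => //;
  [exact: lin_span0|exact: lin_spanD]. Qed.

Lemma lin_span_gen (I : finType) (f : I -> V) i : lin_span f (f i).
Proof.
exists (fun j => (j == i)%:R) => //.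
rewrite (bigD1 i)//= eqxx scale1r big1 ?addr0// => j /negPf->.
by rewrite scale0r.
Qed.

Lemma lin_span_sub (I J : finType) (f : I -> V) (h : J -> V) :
  (forall i, lin_span h (f i)) -> lin_span f `<=` lin_span h.
Proof. by move=> fh _ [c _ <-]; apply: lin_span_sum => i _; exact/lin_spanZ/fh. Qed.

Lemma finite_span_basis (I : finType) (f : I -> V) :
  exists n (g : 'I_n -> I), is_basis (lin_span f) (f \o g).
Proof.
(* A spanning subfamily of minimal size is independent. *)
pose P n : bool := `[< exists g : 'I_n -> I, lin_span (f \o g) = lin_span f >].
have exP : exists n, P n.
  exists #|I|; apply/asboolP; exists (@enum_val I predT).
  apply/seteqP; split; apply: lin_span_sub => i; first exact: lin_span_gen.
  by rewrite -[i](@enum_rankK I) -/((f \o enum_val) (enum_rank i));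
    exact: lin_span_gen.
case: (ex_minnP exP) => n /asboolP[g fg] n_min.
exists n, g; split; last by rewrite -fg.
move=> c c0 i; apply/eqP/negPn/negP => ci.
case: n g fg n_min c c0 i ci => [g _ _ c _ []//|n g fg n_min c c0 i ci].
suff /n_min : P n by rewrite ltnn.
apply/asboolP; exists (g \o lift i); rewrite -fg.
apply/seteqP; split; apply: lin_span_sub => j; first exact: (lin_span_gen (f \o g)).
have [ij|->] := unliftP i j; last first.
  have -> : (f \o g) i = \sum_(k : 'I_n) (- (c i)^-1 * c (lift i k)) *:
    (f \o (g \o lift i)) k.
    move: c0; rewrite (bigD1_ord i)//= => /eqP; rewrite addr_eq0 => /eqP E.
    rewrite -[LHS]scale1r -(mulVf ci) -scalerA E scalerN scaler_sumr -sumrN.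
    by apply: eq_bigr => k _; rewrite scalerA mulNr scaleNr.
  by apply: lin_span_sum => k _; apply: lin_spanZ; exact: lin_span_gen.
by move=> ->; exact: (lin_span_gen (f \o (g \o lift i))).
Qed.

End Span.

Section Bases.
Context (R : realType) (Omega : set (plane R)) (Th : mesh R).
Hypotheses (pol : polygon Omega) (tri : is_triangulation Th Omega).
Implicit Types (T S : {set vertex Th}) (M A B N : vertex Th).
Local Notation coef := ({set vertex Th} -> vertex Th -> R).

Definition residual (c : coef) M := \sum_(T in cells Th | M \in T) c T M.

Lemma field_of_sum (I : finType) (P : pred I) (a : I -> R) (c : I -> coef) :
  \sum_(i | P i) a i *: field_of (c i) =
  field_of (fun T M => \sum_(i | P i) a i * c i T M).
Proof.
rewrite /field_of.
under eq_bigr do rewrite scaler_sumr; rewrite exchange_big /=; apply: eq_bigr => T _.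
under eq_bigr do rewrite scaler_sumr; rewrite exchange_big /=; apply: eq_bigr => M _.
by rewrite scaler_suml; apply: eq_bigr => i _; rewrite scalerA.
Qed.

Lemma field_of_delta T M : T \in cells Th -> M \in T ->
  basis_field T M = field_of (fun T' M' => ((T' == T) && (M' == M))%:R).
Proof.
move=> cT MT; rewrite /field_of (bigD1 T)//= (bigD1 M)//= !eqxx scale1r.
rewrite big1 ?addr0; last first.
  by move=> M' /andP[_ /negPf ->]; rewrite scale0r.
rewrite big1 ?addr0// => T' /andP[_ /negPf ->].
by rewrite big1// => M' _; rewrite scale0r.
Qed.

Lemma residual_delta T M N : T \in cells Th -> M \in T ->
  residual (fun T' M' => ((T' == T) && (M' == M))%:R) N = (N == M)%:R.
Proof.
move=> cT MT; rewrite /residual; have [->|NM] := eqVneq N M; last first.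
  by rewrite big1// => T' _; rewrite andbF.
rewrite (bigD1 T)/=; last by rewrite cT.
by rewrite eqxx big1 ?addr0// => T' /andP[_ /negPf->].
Qed.

Definition balanced (P : pred (vertex Th)) : set (plane R -> plane R) :=
  [set tau | exists2 c : coef, forall M, P M -> residual c M = 0 & tau = field_of c].

Lemma RTnc0E : RTnc0 Th Omega = balanced predT.
Proof.
apply/seteqP; split => [tau [/(RT_field_of tri)[c ->] h]|tau [c c0 ->]].
  exists c => // M _; have := h _ (hat_V1 tri M).
  rewrite (pairing_field_of tri _ (hat_V1 tri M)) (bigD1 M)//= (hat_coord tri) eqxx
    mul1r.
  rewrite [X in _ + X]big1 ?addr0// => N /negPf NM.
  by rewrite (hat_coord tri) NM mul0r.
split; first exact: field_of_RT tri c.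
move=> v v1; rewrite (pairing_field_of tri _ v1) big1// => M _.
by rewrite -/(residual c M) c0// mulr0.
Qed.

(** By [hat_frontier] the hats of interior vertices are admissible and isolate the residuals there;
    conversely test functions vanish at boundary vertices, so residuals there do not matter. *)
Lemma RTncE : RTnc Th Omega = balanced (@interior_vertex R Th Omega).
Proof.
apply/seteqP; split => [tau [/(RT_field_of tri)[c ->] h]|tau [c c0 ->]].
  exists c => // M MI.
  have hM : V10 Th Omega (hat M) by split;
    [exact: hat_V1|move=> x; exact: hat_frontier].
  have := h _ hM.
  rewrite (pairing_field_of tri _ hM.1) (bigD1 M)//= (hat_coord tri) eqxx mul1r.
  rewrite [X in _ + X]big1 ?addr0// => N /negPf NM.
  by rewrite (hat_coord tri) NM mul0r.
split; first exact: field_of_RT tri c.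
move=> v [v1 v0]; rewrite (pairing_field_of tri _ v1) big1// => M _.
have [MI|MB] := boolP (interior_vertex Omega M).
  by rewrite -/(residual c M) c0// mulr0.
rewrite v0 ?mul0r//; move: MB; rewrite (vertex_interior_or_boundary pol tri) negbK.
by move/asboolP.
Qed.

(** * Generators of the balanced fields *)

Definition star_pair (P : pred (vertex Th))
  (x : vertex Th * ({set vertex Th} * {set vertex Th})) :=
  let: (M, (T, T')) := x in
  [&& P M, T \in cells Th, T' \in cells Th, T != T', #|T :&: T'| == 2%N,
    M \in T & M \in T'].

Definition free_slot (P : pred (vertex Th)) (x : vertex Th * {set vertex Th}) :=
  let: (M, T) := x in [&& ~~ P M, T \in cells Th & M \in T].

(** With [P] the interior vertices, the two summands yield Type I and Type II; with [predT] the
    second is empty. *)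
Definition generator (P : pred (vertex Th)) (x : {x | star_pair P x}
  + {x | free_slot P x}) :
    plane R -> plane R :=
  match x with
  | inl u => let: (M, (T, T')) := val u in basis_field T M - basis_field T' M
  | inr u => let: (M, T) := val u in basis_field T M
  end.

Lemma balanced_span (P : pred (vertex Th)) : balanced P = lin_span (@generator P).
Proof.
apply/seteqP; split; last first.
  move=> _ [a _ <-].
  have : forall x : {x | star_pair P x} + {x | free_slot P x}, exists c : coef,
      (forall M, P M -> residual c M = 0) /\ generator x = field_of c.
    case=> [[[M [T T']] sp]|[[M T] fs]] /=.
      have /and5P[PM cT cT' _ /and3P[_ MT MT']] := sp.
      (* The difference is written as a signed sum over [bool], the form required by
         [field_of_sum]. *)
      pose d (b : bool) : coef := fun S N =>
        ((S == (if b then T else T')) && (N == M))%:R.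
      exists (fun S N => \sum_(b : bool) (if b then 1 else - 1) * d b S N); split.
        move=> N PN; rewrite /residual exchange_big /= big_bool /=.
        by rewrite -!mulr_sumr -!/(residual _ N) !residual_delta// mul1r mulN1r subrr.
      rewrite -(field_of_sum predT (fun b : bool =>
        if b then 1 else - 1) d) big_bool /=.
      by rewrite scale1r scaleN1r !field_of_delta.
    have /and3P[PM cT MT] := fs.
    exists (fun S N => ((S == T) && (N == M))%:R); split; last exact: field_of_delta.
    move=> N PN; rewrite residual_delta//.
    by have [NM|] := eqVneq N M => //; rewrite -NM PN in PM.
  move=> /choice[c hc].
  under eq_bigr do rewrite (hc _).2.
  rewrite field_of_sum; exists (fun T M => \sum_x a x * c x T M) => // M PM.
  rewrite /residual exchange_big /= big1// => x _.
  by rewrite -mulr_sumr -/(residual _ M) (hc x).1// mulr0.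
move=> _ [c c0 ->].
rewrite /field_of (exchange_big_dep predT)//=; apply: lin_span_sum => M _.
have [PM|PM] := boolP (P M); last first.
  apply: lin_span_sum => T /andP[cT MT]; apply: lin_spanZ.
  have fs : free_slot P (M, T) by rewrite /= PM cT.
  exact: (lin_span_gen (@generator P) (inr (exist _ (M, T) fs))).
have [T0 cT0 MT0] := tri_vertex tri M.
(* The cells at [M] whose difference from [T0] is spanned. Crossing an edge at [M] adds one
   generator, so [star_connected] gives the whole star. *)
pose C := [set T in cells Th | (M \in T) &&
  `[< lin_span (@generator P) (basis_field T M - basis_field T0 M) >] ]%SET.
have CP T : T \in C -> T \in cells Th /\ M \in T by rewrite inE => /and3P[].
have C_closed T T' A : T \in C -> T' \in cells Th -> M \in T' -> A != M ->
    A \in T -> A \in T' -> T' \in C.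
  rewrite inE => /and3P[cT MT /asboolP spT] cT' MT' AM AT AT'.
  rewrite inE cT' MT' /=; apply/asboolP.
  have [<-//|TT'] := eqVneq T T'.
  have TT'2 : #|T :&: T'| == 2%N.
    rewrite eqn_leq; apply/andP; split.
      rewrite -ltnS -[X in (_ < X)%N](cell_card tri cT) proper_card//
        finset.properEneq finset.subsetIl andbT.
      apply: contra TT' => /eqP/finset.setIidPl TT'; apply/eqP.
      exact: (cell_subset tri cT cT' TT').
    have <- : #|[set M; A]%SET| = 2%N by rewrite cards2 eq_sym AM.
    by apply/subset_leq_card/fintype.subsetP => i; rewrite !inE => /orP[]/eqP->;
      rewrite ?MT ?AT.
  have sp : star_pair P (M, (T', T)).
    by rewrite /= PM cT cT' eq_sym TT' finset.setIC TT'2 MT MT'.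
  have := lin_spanD (lin_span_gen (@generator P) (inl (exist _ (M, (T', T)) sp))) spT.
  by rewrite /= addrA subrK.
have C0 : T0 \in C.
  by rewrite inE cT0 MT0 /=; apply/asboolP; rewrite subrr; exact: lin_span0.
have span T : T \in cells Th -> M \in T ->
  lin_span (@generator P) (basis_field T M - basis_field T0 M).
  move=> cT MT; have := star_connected pol tri CP C_closed C0 cT MT.
  by rewrite inE => /and3P[_ _ /asboolP].
(* The residual being zero, [basis_field T0 M] may be subtracted in every term. *)
have -> : \sum_(T in cells Th | M \in T) c T M *: basis_field T M =
    \sum_(T in cells Th | M \in T) c T M *: (basis_field T M - basis_field T0 M).
  under [RHS]eq_bigr do rewrite scalerBr.
  by rewrite sumrB -scaler_suml -/(residual c M) c0// scale0r subr0.
by apply: lin_span_sum => T /andP[cT MT]; exact/lin_spanZ/span.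
Qed.

(** * Direct sums and the types of the generators *)

Lemma star_sum_field_of M (a : {set vertex Th} -> R) :
  \sum_(T in cells Th | M \in T) a T *: basis_field T M =
  field_of (fun T N => (N == M)%:R * a T).
Proof.
rewrite /field_of big_mkcondr /=; apply: eq_bigr => T cT.
have [MT|MT] := boolP (M \in T).
  rewrite (bigD1 M)//= eqxx mul1r big1 ?addr0// => N /andP[_ /negPf->].
  by rewrite mul0r scale0r.
rewrite big1// => N NT; have [NM|] := eqVneq N M; last by rewrite mul0r scale0r.
by rewrite -NM NT in MT.
Qed.

Lemma lines_coef M (g : {set vertex Th} -> plane R -> plane R) :
  (forall T, (T \in cells Th) && (M \in T) -> line (ext0 T (bT T M)) (g T)) ->
  exists a, forall T, (T \in cells Th) && (M \in T) -> g T = a T *: basis_field T M.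
Proof.
move=> gl; suff /choice[a ag] : forall T, exists a : R,
    (T \in cells Th) && (M \in T) -> g T = a *: basis_field T M by exists a.
move=> T.
have [h|h] := boolP ((T \in cells Th) && (M \in T)); last by exists 0.
by have [a _ <-] := gl T h; exists a.
Qed.

(** Directness of the sum, part of [dsum], comes from [field_of_inj]. *)
Lemma CMP M tau :
  CM M tau <-> exists a, tau = \sum_(T in cells Th | M \in T) a T *: basis_field T M.
Proof.
split=> [[_ [g /lines_coef[a ag] ->]]|[a ->]]; first by exists a; exact: eq_bigr.
split; last by exists (fun T => a T *: basis_field T M) => // T _; exists (a T).
move=> g /lines_coef[b bg]; rewrite (eq_bigr _ bg) star_sum_field_of.
move=> /(field_of_inj tri) b0 T TM; have /andP[cT MT] := TM.
by rewrite bg//; have := b0 T M cT MT; rewrite eqxx mul1r => ->; rewrite scale0r.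
Qed.

Lemma CM0 M : CM M (0 : plane R -> plane R).
Proof.
by apply/CMP; exists (fun=> 0); rewrite big1// => T _; rewrite scale0r.
Qed.

Lemma CM_independent (P : pred (vertex Th)) : independent_sum P (@CM R Th).
Proof.
move=> g gC g0 M PM.
have /choice[a ag] : forall N, exists a : {set vertex Th} -> R, P N ->
    g N = field_of (fun T N' => (N' == N)%:R * a T).
  move=> N; have [PN|PN] := boolP (P N); last by exists (fun=> 0).
  by have /CMP[a ->] := gC N PN; exists a => _; rewrite star_sum_field_of.
have {}g0 : field_of (fun T N' => \sum_(N | P N) 1 * ((N' == N)%:R * a N T)) = 0.
  rewrite -[RHS]g0 -(field_of_sum P (fun=> 1) (fun N T N' => (N' == N)%:R * a N T)).
  by apply: eq_bigr => N PN; rewrite scale1r ag.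
rewrite ag// /field_of big1// => T cT; rewrite big1// => N NT.
have [NM|] := eqVneq N M; last by rewrite mul0r scale0r.
subst N; have := field_of_inj tri g0 cT NT.
rewrite (bigD1 M)//= eqxx !mul1r big1 ?addr0; first by move=> ->; rewrite scale0r.
by move=> N /andP[_]; rewrite eq_sym => /negPf->; rewrite mul0r mulr0.
Qed.

(** Directness passes from the spaces [CM N] to the subsets [W N]; the other components are zero. *)
Lemma dsum_summand (P : pred (vertex Th)) (W : vertex Th ->
  set (plane R -> plane R)) M tau :
  (forall N, W N `<=` CM N) -> (forall N, W N 0) -> P M -> W M tau -> dsum P W tau.
Proof.
move=> WC W0 PM WM; split.
  by move=> g gW; apply: CM_independent => N PN; apply: WC; exact: gW.
exists (fun N => if N == M then tau else 0).
  by move=> N _; case: eqP => [->|].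
by rewrite (bigD1 M)//= eqxx big1 ?addr0// => N /andP[_ /negPf->].
Qed.

(** Such a field is in [RTnc0], so it is tested to zero by [psi Omega M] in particular. *)
Lemma BM_balanced M tau : CM M tau -> balanced predT tau -> BM Omega M tau.
Proof.
by rewrite -RTnc0E => CMtau [_ h]; split => //; apply: h; case: (psi_nodal tri M).
Qed.

Lemma supp_basis_field T M : T \in cells Th -> supp (basis_field T M) `<=` hull T.
Proof.
move=> cT; have /closure_id -> := closed_hull (cell_card tri cT) (cell_ind tri cT).
apply: closure_subset => x /=; rewrite /basis_field /ext0 /patch.
by case: ifPn; [rewrite inE => /interior_subset|rewrite eqxx].
Qed.

Lemma supp_sub (f g : plane R -> plane R) : supp (f - g) `<=` supp f `|` supp g.
Proof.
rewrite /supp -closureU; apply: closure_subset => x /= fg.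
have [fx|] := eqVneq (f x) 0; last by left.
by right; apply: contra_neq fg => gx; rewrite !fctE fx gx subrr.
Qed.

Lemma star_pair_BM P M T T' : star_pair P (M, (T, T')) ->
  BM Omega M (basis_field T M - basis_field T' M).
Proof.
move=> sp; have /and5P[PM cT cT' _ /and3P[_ MT MT']] := sp.
apply: BM_balanced.
  apply/CMP; exists (fun S => (S == T)%:R - (S == T')%:R).
  under eq_bigr do rewrite scalerBl; rewrite sumrB.
  rewrite (bigD1 T)/= ?cT// eqxx scale1r big1 ?addr0; last first.
    by move=> S /andP[_ /negPf->]; rewrite scale0r.
  rewrite (bigD1 T')/= ?cT'// eqxx scale1r big1 ?addr0//.
  by move=> S /andP[_ /negPf->]; rewrite scale0r.
rewrite balanced_span.
have sp' : star_pair predT (M, (T, T')) by move: sp => /= /andP[].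
exact: (lin_span_gen (@generator predT) (inl (exist _ (M, (T, T')) sp'))).
Qed.

Lemma star_pair_supp P M T T' : star_pair P (M, (T, T')) ->
  on_two_adjacent Th (basis_field T M - basis_field T' M).
Proof.
move=> /and5P[_ cT cT' TT' /and3P[/eqP TT'2 _ _]]; exists T, T'; split => //.
apply: subset_trans (@supp_sub _ _) _.
by apply: setUSS; exact: supp_basis_field.
Qed.

Lemma star_pair_dsum P M T T' : star_pair P (M, (T, T')) ->
  dsum P (@BM R Th Omega) (basis_field T M - basis_field T' M).
Proof.
move=> sp; have /andP[PM _] := sp; apply: dsum_summand PM (star_pair_BM sp).
  by move=> N t [].
by move=> N; apply: BM_balanced; [exact: CM0|rewrite balanced_span; exact: lin_span0].
Qed.

Lemma boundary_slot_typeII M T : free_slot (@interior_vertex R Th Omega) (M, T) ->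
  typeII Th Omega (basis_field T M).
Proof.
move=> /and3P[MB cT MT]; split; last by exists T => //; exact: supp_basis_field.
rewrite (vertex_interior_or_boundary pol tri) negbK in MB.
apply: (@dsum_summand _ (@CM R Th) M _ _ CM0 MB); first by move=> N t.
apply/CMP; exists (fun S => (S == T)%:R); rewrite (bigD1 T)/= ?cT// eqxx scale1r.
by rewrite big1 ?addr0// => S /andP[_ /negPf->]; rewrite scale0r.
Qed.

End Bases.

Theorem theorem2p6 (R : realType) (Omega : set (plane R)) (Th : mesh R)
    (gamma : R)
    (polygon_Omega : polygon Omega)
    (triangulation_Th : is_triangulation Th Omega)
    (regular_Th : shape_regular Th gamma)
    (boundary_to_interior : forall M : vertex Th, boundary_vertex Omega M ->
       exists2 M' : vertex Th, interior_vertex Omega M' & edge M M') :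
  (exists (n : nat) (e : 'I_n -> plane R -> plane R),
     is_basis (RTnc0 Th Omega) e /\
     forall i, dsum predT (@BM R Th Omega) (e i) /\ on_two_adjacent Th (e i)) /\
  (exists (n : nat) (e : 'I_n -> plane R -> plane R),
     is_basis (RTnc Th Omega) e /\
     forall i, typeI Th Omega (e i) \/ typeII Th Omega (e i)).
Proof.
split.
  rewrite (RTnc0E triangulation_Th) (balanced_span polygon_Omega triangulation_Th).
  have [n [g basis_g]] := finite_span_basis (@generator R Th predT).
  exists n, (@generator R Th predT \o g); split => // i /=.
  (* A free slot requires a vertex outside [predT], so only differences occur. *)
  case: (g i) => [[[M [T T']] sp]|[[M T] fs]]; last by have := fs.
  split; first exact: (star_pair_dsum polygon_Omega triangulation_Th sp).
  exact: (star_pair_supp triangulation_Th sp).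
rewrite (RTncE polygon_Omega triangulation_Th).
rewrite (balanced_span polygon_Omega triangulation_Th).
have [n [g basis_g]] := finite_span_basis
  (@generator R Th (@interior_vertex R Th Omega)).
exists n, (@generator R Th (@interior_vertex R Th Omega) \o g); split => // i /=.
case: (g i) => [[[M [T T']] sp]|[[M T] fs]]; [left|right].
  by split; [exact: (star_pair_dsum polygon_Omega triangulation_Th sp)|exact:
    (star_pair_supp triangulation_Th sp)].
exact: (boundary_slot_typeII polygon_Omega triangulation_Th fs).
Qed.
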